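(* Let $\omega\neq 0$ be real, let $N\ge 1$ be an integer, $h=1/N$, $x_\beta=h\beta$ for $\beta=0,1,\dots,N$, and fix $z\in[0,1]$. Let $G_2$, $p$, $C$, $A$, $\lambda$ (with $|\lambda|<1$), $K_1,\dots,K_8$, $A_{11},A_{12},A_{21},A_{22}$, $S_1,S_2$ be the quantities defined in the context, and assume that all denominators occurring in these definitions and in the formulas below are nonzero (in particular $\cos\omega\neq0$). Then the coefficients of the optimal interpolation formula $\varphi(z)\cong\sum_{\beta=0}^N C_\beta(z)\varphi(h\beta)$ in the space $K_2(P_2)$ (i.e. the coefficients minimizing the norm of the error functional) are $$C_0(z)=p\Big[-d_1^-(z)\sin(\omega h)+d_2^-(z)\cos(\omega h)-\frac{h}{4\omega^2}\cos(\omega(h+z))+C\,G_2(z)+G_2(z-h)+\frac{A}{\lambda}\Big(\sum_{\gamma=0}^N\lambda^{\gamma}G_2(z-h\gamma)+M_1+\lambda^N N_1\Big)\Big],$$ $$C_\beta(z)=p\Big[G_2(z-h(\beta-1))+C\,G_2(z-h\beta)+G_2(z-h(\beta+1))+\frac{A}{\lambda}\Big(\sum_{\gamma=0}^N\lambda^{|\beta-\gamma|}G_2(z-h\gamma)+\lambda^{\beta}M_1+\lambda^{N-\beta}N_1\Big)\Big],\quad \beta=1,2,\dots,N-1,$$ $$C_N(z)=p\Big[d_1^+(z)\sin(\omega h(N+1))+d_2^+(z)\cos(\omega h(N+1))-\frac{h(N+1)}{4\omega^2}\cos(\omega(h(N+1)-z))+C\,G_2(z-1)+G_2(z-h(N-1))+\frac{A}{\lambda}\Big(\sum_{\gamma=0}^N\lambda^{N-\gamma}G_2(z-h\gamma)+\lambda^N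 M_1+N_1\Big)\Big],$$ where $$M_1=-d_1^-(z)\frac{\lambda\sin(\omega h)}{\lambda^2-2\lambda\cos(\omega h)+1}+d_2^-(z)K_5-\frac{h}{4\omega^2}K_2,\qquad N_1=d_1^+(z)K_8+d_2^+(z)K_1-\frac{h}{4\omega^2}K_3,$$ $$d_1^-(z)=\frac{S_1A_{22}-S_2A_{12}}{A_{11}A_{22}-A_{21}A_{12}},\qquad d_1^+(z)=\frac{S_2A_{11}-S_1A_{21}}{A_{11}A_{22}-A_{21}A_{12}},$$ $$d_2^-(z)=G_2(z),\qquad d_2^+(z)=\frac{1}{\cos\omega}\Big[G_2(z-1)+\frac{\cos(\omega(1-z))}{4\omega^2}-d_1^+(z)\sin\omega\Big].$$
   Context: **Space.** $K_2(P_2)$ is the class of all real functions $\varphi$ on $[0,1]$ having an absolutely continuous first derivative on $[0,1]$ and second derivative in $L_2(0,1)$, with the pseudo-inner product $\langle\varphi,\psi\rangle=\int_0^1(\varphi''(x)+\omega^2\varphi(x))(\psi''(x)+\omega^2\psi(x))\,dx$ and corresponding semi-norm $\|\varphi\|=\big(\int_0^1(\varphi''(x)+\omega^2\varphi(x))^2dx\big)^{1/2}$; it is a Hilbert space when functions differing by a linear combination of $\sin(\omega x)$ and $\cos(\omega x)$ are identified. **Optimal interpolation formula.** For fixed $z\in[0,1]$ and nodes $x_\beta=h\beta$, the error functional of the formula $\varphi(z)\cong\sum_{\beta=0}^N C_\beta(z)\varphi(x_\beta)$ is $(\ell,\varphi)=\varphi(z)-\sum_{\beta=0}^N C_\beta(z)\varphi(x_\beta)$.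 Its norm is $\|\ell\|=\sup_{\|\varphi\|\ne0}|(\ell,\varphi)|/\|\varphi\|$, the supremum being over $\varphi\in K_2(P_2)$. For $\ell$ to be a well-defined bounded functional on $K_2(P_2)$ one needs $(\ell,\sin(\omega x))=0$ and $(\ell,\cos(\omega x))=0$, i.e. $\sum_\gamma C_\gamma(z)\sin(\omega x_\gamma)=\sin(\omega z)$ and $\sum_\gamma C_\gamma(z)\cos(\omega x_\gamma)=\cos(\omega z)$. The optimal coefficients are the $C_\beta(z)$ for which $\|\ell\|$ attains its infimum over all choices of coefficients, the nodes being fixed; the corresponding formula is the optimal interpolation formula. **Notation.** $G_2(x)=\dfrac{\operatorname{sgn}x}{4\omega^3}\,[\sin(\omega x)-\omega x\cos(\omega x)]$ (with $\operatorname{sgn}0=0$). $p=\dfrac{2\omega^3}{\sin(\omega h)-\omega h\cos(\omega h)}$, $\quad C=\dfrac{2h\omega\cos(2h\omega)-\sin(2h\omega)}{\sin(h\omega)-h\omega\cos(h\omega)}$, $\lambda=\dfrac{2h\omega-\sin(2h\omega)-2\sin(h\omega)\sqrt{(h\omega)^2-\sin^2(h\omega)}}{2(h\omega\cos(h\omega)-\sin(h\omega))}$, with $|\lambda|<1$, $A=\dfrac{(2h\omega)^2\sin^4(h\omega)\,\lambda^2}{(\lambda^2-1)(\sin(h\omega)-h\omega\cos(h\omega))^2}$. $K_1=\dfrac{\lambda(\cos(\omega(1+h))-\lambda\cos\omega)}{\lambda^2-2\lambda\cos(\omega h)+1}$, $K_2=\dfrac{\lambda(\lambda^2\cos(\omega(h-z))-2\lambda\cos(\omega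 z)+\cos(\omega(h+z)))}{(\lambda^2-2\lambda\cos(\omega h)+1)^2}$, $K_3=\sum_{\gamma=1}^\infty\lambda^\gamma(N+\gamma)\cos(\omega(h(N+\gamma)-z))$, $K_4=\sum_{\gamma=0}^N\lambda^\gamma G_2(z-h\gamma)$, $K_5=\dfrac{\lambda(\cos(\omega h)-\lambda)}{\lambda^2-2\lambda\cos(\omega h)+1}$, $K_6=\cos\omega+C\cos(\omega h(N+1))+\cos(\omega h(N+2))+\dfrac{AK_1}{\lambda^2}$, $K_7=\sum_{\gamma=0}^N\lambda^{-\gamma}G_2(z-h\gamma)$, $K_8=\dfrac{\lambda(\sin(\omega(h+1))-\lambda\sin\omega)}{\lambda^2-2\lambda\cos(\omega h)+1}$. $A_{11}=-\sin(2\omega h)-C\sin(\omega h)-\dfrac{A\sin(\omega h)}{\lambda(\lambda^2-2\lambda\cos(\omega h)+1)}$, $A_{12}=\dfrac{A\lambda^{N+1}\sin(\omega h)}{\cos(\omega)\,(\lambda^2-2\lambda\cos(\omega h)+1)}$, $A_{21}=-\dfrac{A\lambda^{N+1}\sin(\omega h)}{\lambda^2-2\lambda\cos(\omega h)+1}$, $A_{22}=\dfrac{1}{\cos\omega}\Big[C\sin(\omega h)+\sin(2\omega h)+\dfrac{A\sin(\omega h)}{\lambda(\lambda^2-2\lambda\cos(\omega h)+1)}\Big]$. $S_1=\dfrac{1}{4\omega^2}\Big(Ch\cos(\omega(h+z))+2h\cos(\omega(2h+z))-\dfrac{A\lambda^N\cos(\omega(1-z))}{\cos\omega}K_1+\dfrac{Ah}{\lambda^2}K_2+Ah\lambda^NK_3\Big)-AK_4-\dfrac{A\lambda^NG_2(z-1)}{\cos\omega}K_1-G_2(z)\Big(C\cos(\omega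 h)+1+\cos(2\omega h)+\dfrac{A}{\lambda^2}K_5\Big)$, $S_2=\dfrac{1}{4\omega^2}\Big(A\lambda^NhK_2+\cos(\omega(1-z))+Ch(N+1)\cos(\omega(h(N+1)-z))+h(N+2)\cos(\omega(h(N+2)-z))+\dfrac{AhK_3}{\lambda^2}-\dfrac{\cos(\omega(1-z))K_6}{\cos\omega}\Big)-A\lambda^NK_7-G_2(z)A\lambda^NK_5-\dfrac{G_2(z-1)}{\cos\omega}K_6$. *)

(* Defs.v *)
From mathcomp Require Import all_boot all_order all_algebra.
From mathcomp Require Import all_classical all_reals all_analysis.

Set Implicit Arguments.
Unset Strict Implicit.
Unset Printing Implicit Defensive.

Import Order.TTheory GRing.Theory Num.Theory.
Import numFieldNormedType.Exports.

Local Open Scope classical_set_scope.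
Local Open Scope ring_scope.

(* A real function on [0, 1] is a function R -> R; nothing below depends on
   its values outside [0, 1]. *)
Section K2_space.
Context (R : realType).
Implicit Types (f g phi : R -> R) (omega : R).

Definition absolutely_continuous_on (a b : R) f : Prop :=
  forall e : R, 0 < e -> exists2 d : R, 0 < d &
    forall (n : nat) (u v : 'I_n -> R),
      (forall i, a <= u i /\ u i <= v i /\ v i <= b) ->
      trivIset setT (fun i => `]u i, v i[%classic) ->
      \sum_(i < n) (v i - u i) < d ->
      \sum_(i < n) `|f (v i) - f (u i)| < e.

(* The limit is taken within [0, 1], so the derivatives at 0 and 1 are
   one-sided. *)
Definition has_derivative_on01 f g : Prop :=
  forall x : R, 0 <= x <= 1 ->
    (f y - f x) / (y - x) @[y --> within `[0, 1]%classic x^'] --> g x.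

(* derive1 phi coincides with the first derivative phi1 on ]0, 1[, so derive1n 2 phi is
   the second derivative at almost every point of ]0, 1[; it is the library's
   default value where derive1 phi is not derivable. *)
Definition in_K2 phi : Prop :=
  (exists2 phi1 : R -> R, has_derivative_on01 phi phi1 &
     absolutely_continuous_on 0 1 phi1) /\
  {ae @lebesgue_measure R, forall x : R, x \in `]0, 1[ -> derivable (derive1 phi) x 1} /\
  derive1n 2 phi \_ `]0, 1[%classic \in Lfun (@lebesgue_measure R) 2%:E.

Definition K2_norm omega phi : R :=
  Num.sqrt (\int[@lebesgue_measure R]_(x in `]0, 1[%classic)
              (derive1n 2 phi x + omega ^+ 2 * phi x) ^+ 2).

Definition step (N : nat) : R := N%:R^-1.

Definition error_functional (N : nat) (z : R) (c : 'I_N.+1 -> R) phi : R :=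
  phi z - \sum_(b < N.+1) c b * phi (step N * b%:R).

(* Equal to +oo when the functional is unbounded. *)
Definition error_norm omega (N : nat) (z : R) (c : 'I_N.+1 -> R) : \bar R :=
  ereal_sup [set (`|error_functional z c phi| / K2_norm omega phi)%:E
            | phi in [set phi | in_K2 phi /\ K2_norm omega phi != 0]].

Definition optimal_coefficients omega (N : nat) (z : R)
    (c : 'I_N.+1 -> R) : Prop :=
  [/\ error_functional z c (fun x => sin (omega * x)) = 0,
      error_functional z c (fun x => cos (omega * x)) = 0
    & forall c' : 'I_N.+1 -> R,
        (error_norm omega z c <= error_norm omega z c')%E].

End K2_space.

Section constants.
Context (R : realType) (omega : R) (N : nat) (z : R).

Local Notation h := (step R N).

Definition G2 (x : R) : R :=
  Num.sg x / (4 * omega ^+ 3) * (sin (omega * x) - omega * x * cos (omega * x)).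

Definition p_cst : R :=
  2 * omega ^+ 3 / (sin (omega * h) - omega * h * cos (omega * h)).

Definition C_cst : R :=
  (2 * h * omega * cos (2 * h * omega) - sin (2 * h * omega))
  / (sin (h * omega) - h * omega * cos (h * omega)).

Definition lambda : R :=
  (2 * h * omega - sin (2 * h * omega)
   - 2 * sin (h * omega) * Num.sqrt ((h * omega) ^+ 2 - sin (h * omega) ^+ 2))
  / (2 * (h * omega * cos (h * omega) - sin (h * omega))).

Local Notation lam := lambda.

Definition A_cst : R :=
  ((2 * h * omega) ^+ 2 * sin (h * omega) ^+ 4 * lam ^+ 2)
  / ((lam ^+ 2 - 1) * (sin (h * omega) - h * omega * cos (h * omega)) ^+ 2).

Local Notation C := C_cst.
Local Notation A := A_cst.

Definition lambda_den : R := lam ^+ 2 - 2 * lam * cos (omega * h) + 1.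

Local Notation Q := lambda_den.

Definition K1 : R := lam * (cos (omega * (1 + h)) - lam * cos omega) / Q.

Definition K2 : R :=
  lam * (lam ^+ 2 * cos (omega * (h - z)) - 2 * lam * cos (omega * z)
         + cos (omega * (h + z))) / Q ^+ 2.

(* The sum over gamma >= 1, indexed by gamma = k.+1. *)
Definition K3 : R :=
  limn (series (fun k : nat => lam ^+ k.+1 * (N + k.+1)%:R
                               * cos (omega * (h * (N + k.+1)%:R - z)))).

Definition K4 : R := \sum_(g < N.+1) lam ^+ g * G2 (z - h * g%:R).

Definition K5 : R := lam * (cos (omega * h) - lam) / Q.

Definition K6 : R :=
  cos omega + C * cos (omega * h * N.+1%:R) + cos (omega * h * N.+2%:R)
  + A * K1 / lam ^+ 2.

Definition K7 : R := \sum_(g < N.+1) lam ^- g * G2 (z - h * g%:R).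

Definition K8 : R := lam * (sin (omega * (h + 1)) - lam * sin omega) / Q.

Definition A11 : R :=
  - sin (2 * omega * h) - C * sin (omega * h) - A * sin (omega * h) / (lam * Q).

Definition A12 : R := A * lam ^+ N.+1 * sin (omega * h) / (cos omega * Q).

Definition A21 : R := - (A * lam ^+ N.+1 * sin (omega * h) / Q).

Definition A22 : R :=
  (cos omega)^-1 * (C * sin (omega * h) + sin (2 * omega * h)
                    + A * sin (omega * h) / (lam * Q)).

Definition S1 : R :=
  (4 * omega ^+ 2)^-1 *
    (C * h * cos (omega * (h + z)) + 2 * h * cos (omega * (2 * h + z))
     - A * lam ^+ N * cos (omega * (1 - z)) / cos omega * K1
     + A * h / lam ^+ 2 * K2 + A * h * lam ^+ N * K3)
  - A * K4 - A * lam ^+ N * G2 (z - 1) / cos omega * K1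
  - G2 z * (C * cos (omega * h) + 1 + cos (2 * omega * h) + A / lam ^+ 2 * K5).

Definition S2 : R :=
  (4 * omega ^+ 2)^-1 *
    (A * lam ^+ N * h * K2 + cos (omega * (1 - z))
     + C * h * N.+1%:R * cos (omega * (h * N.+1%:R - z))
     + h * N.+2%:R * cos (omega * (h * N.+2%:R - z))
     + A * h * K3 / lam ^+ 2 - cos (omega * (1 - z)) * K6 / cos omega)
  - A * lam ^+ N * K7 - G2 z * A * lam ^+ N * K5 - G2 (z - 1) / cos omega * K6.

Definition A_det : R := A11 * A22 - A21 * A12.

Definition d1_minus : R := (S1 * A22 - S2 * A12) / A_det.

Definition d1_plus : R := (S2 * A11 - S1 * A21) / A_det.

Definition d2_minus : R := G2 z.

Definition d2_plus : R :=
  (cos omega)^-1 * (G2 (z - 1) + cos (omega * (1 - z)) / (4 * omega ^+ 2)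
                    - d1_plus * sin omega).

Definition M1 : R :=
  - d1_minus * (lam * sin (omega * h) / Q) + d2_minus * K5
  - h / (4 * omega ^+ 2) * K2.

Definition N1 : R :=
  d1_plus * K8 + d2_plus * K1 - h / (4 * omega ^+ 2) * K3.

End constants.

(* Main.v *)
Require Import Defs.
From mathcomp Require Import all_boot all_order all_algebra.
From mathcomp Require Import all_classical all_reals all_analysis.
From mathcomp Require Import measurable_realfun.
From mathcomp Require Import ring lra zify.

Set Implicit Arguments.
Unset Strict Implicit.
Unset Printing Implicit Defensive.

Import Order.TTheory GRing.Theory Num.Theory.
Import numFieldNormedType.Exports.

Local Open Scope classical_set_scope.
Local Open Scope ring_scope.

(** Write L for the operator phi |-> phi'' + omega^2 phi, so that the squared
    semi-norm of phi is the integral of (L phi)^2 over ]0, 1[.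

    Representation.  A function of the space satisfies the variation-of-constants
    formula
      phi(y) = A cos(omega y) + B sin(omega y)
               + int_0^y sin(omega (y - t)) / omega (L phi)(t) dt
    ([K2_variation_of_constants]); as phi' is only absolutely continuous, this rests
    on the fundamental theorem of calculus for absolutely continuous functions
    ([abs_cont_FTC]).  Hence a combination of point evaluations that kills
    sin(omega x) and cos(omega x) is phi |-> int u (L phi), where u is the same
    combination of translates of the Green function sin(omega |x|) / (2 omega)
    ([point_functional_repr]).  Because L G2 is that Green function, u is also L P
    for the spline P built with G2 in place of the Green function, plus any
    a sin(omega x) + b cos(omega x) ([spline_wave_op]).

    Optimality.  Suppose the weights c and the numbers a, b are such that the error
    functional kills sine and cosine and that P vanishes at the nodes
    ([spline_system]).  Every error functional, whatever its weights, then takes at P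
    the value P(z) = int u^2, so its norm is at least |P|; by Cauchy-Schwarz the norm
    for c is at most |P|.  So c is optimal ([spline_system_optimal]), and perturbing P
    by multiples of polynomials shows that nothing else is ([optimal_unique]).  The
    system is square, and its homogeneous version has only the zero solution, again
    because int u^2 = 0 forces u = 0; so it is solvable ([spline_system_exists]).

    Closed formula.  It remains to solve the system.  Extend the data G2(z - x_b) from
    the nodes to all of h Z by the convolution of the weights with G2, up to a sine and a
    cosine ([data_ext]).  With theta = omega h,
    the square of the three-term operator E - 2 cos(theta) + E^-1, where E is the shift
    by one step, kills samples of sine, cosine and their multiples by the index, and
    turns samples of G2 into a three-term expression with characteristic roots
    lambda and 1 / lambda ([data_rec]).
    Factoring that expression inverts the convolution with G2: a weight is a local
    combination of three data plus two one-sided geometric sums of the data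
    ([coef_formula]).  Outside [0, 1] the data are explicit up to two unknowns, which
    gives the tails M1 and N1 of the geometric sums ([left_value], [right_value]); the
    unknowns are determined by the vanishing of the weights at the two points next to
    the grid, a 2 x 2 system solved by Cramer's rule.
*)

(** * Absolutely continuous functions and the fundamental theorem of calculus *)

Section AC.
Context {R : realType}.
Notation mu := (@lebesgue_measure R).

Lemma trivIset_chain n (u v : nat -> R) :
  (forall i j, (i < j < n)%N -> v i <= u j) ->
  trivIset `I_n (fun i => `]u i, v i[%classic).
Proof.
move=> uv i j /= ni nj [x [/=]]; rewrite !in_itv/= => /andP[ux xv] /andP[ux' xv'].
case: (ltngtP i j) => // ij; exfalso.
  have := uv i j; rewrite ij nj => /(_ isT); lra.
have := uv j i; rewrite ij ni => /(_ isT); lra.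
Qed.

Lemma open_cover_null_small (Z : set R) (d : R) : 0 < d ->
  mu.-negligible Z ->
  exists U : set R, [/\ open U, Z `<=` U & (mu U < d%:E)%E].
Proof.
move=> d0 nZ; suff main (A : set R) : measurable A -> mu A = 0%E -> Z `<=` A ->
    exists U : set R, [/\ open U, Z `<=` U & (mu U < d%:E)%E].
  by case: nZ => A [mA A0 ZA]; exact: (main A mA A0 ZA).
move=> mA A0 ZA; have Afin : (mu A < +oo)%E by rewrite A0.
have [U [oU AU Ud]] := lebesgue_regularity_outer mA Afin d0.
exists U; split => //; first exact: subset_trans AU.
have mU : measurable U by exact: open_measurable.
have -> : mu U = (mu A + mu (U `\` A))%E.
  rewrite -measureU ?setDUK //; first exact: measurableD.
  by rewrite setDIK.
by rewrite A0 add0e.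
Qed.

(** This bounds the total length of the chains produced by the continuity induction below,
    through the measure of a set that covers them. *)
Lemma chain_measure n (u v : nat -> R) (U : set R) : measurable U ->
  (forall i, (i < n)%N -> u i <= v i) ->
  (forall i, (i < n)%N -> `]u i, v i[%classic `<=` U) ->
  (forall i j, (i < j < n)%N -> v i <= u j) ->
  ((\sum_(i < n) (v i - u i))%:E <= mu U)%E.
Proof.
move=> mU uv uvU chain.
have tI := trivIset_chain chain.
have mI i : measurable (`]u i, v i[%classic : set R) by [].
have -> : (\sum_(i < n) (v i - u i))%:E = mu (\big[setU/set0]_(i < n) `]u i, v i[%classic).
  rewrite (measure_semi_additive_ord_I mu (fun i _ => mI i) tI); last first.
    exact: bigsetU_measurable.
  rewrite -sumEFin; apply: eq_bigr => i _.
  suff : (v i - u i)%:E = lebesgue_measure (`]u i, v i[%classic : set R) by [].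
  rewrite lebesgue_measure_itv.
  rewrite /= lte_fin; case: ltP => //= vu.
  by congr EFin; have := uv i (ltn_ord i); lra.
apply: le_measure; rewrite ?inE//; first exact: bigsetU_measurable.
rewrite -(bigcup_mkord n (fun i => `]u i, v i[%classic)) => x [i /= ni]; exact: uvU.
Qed.

(** The points where H' fails to vanish are covered by an open set U of measure smaller
    than the modulus of absolute continuity. Moving from a to b, a step inside U is charged
    to absolute continuity and any other step to a small slope; a supremum argument turns
    this into a finite chain reaching b. *)
Lemma abs_cont_zero_derivative (a b : R) (H : R -> R) : a <= b ->
  absolutely_continuous_on a b H ->
  {ae mu, forall x : R, x \in `]a, b[ -> is_derive x 1 H 0} ->
  H b = H a.
Proof.
move=> ab acH dH.
suff main : forall e : R, 0 < e -> `|H b - H a| <= e.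
  apply/eqP; rewrite -subr_eq0 -normr_le0; apply/ler_addgt0Pl => e e0.
  by rewrite addr0; exact: main.
move=> e0 e0_gt0; pose e : R := e0 / 2 / (1 + (b - a)).
have e_gt0 : 0 < e by rewrite !divr_gt0//; lra.
have eba : e * (b - a) <= e0 / 2.
  by rewrite /e -mulrA ger_pMr ?divr_gt0// mulrC ler_pdivrMr; lra.
have [d d0 acd] := acH (e0 / 2) (divr_gt0 e0_gt0 (ltr0n _ 2)).
(* The endpoints are put in the exceptional set: nothing is known about the derivative there. *)
have nZ : mu.-negligible
    ((~` [set x : R | x \in `]a, b[ -> is_derive x 1 H 0]) `|` [set a; b]).
  apply: negligibleU; first exact: dH.
  exists [set a; b]; split => //; first by apply: measurableU; exact: measurable_set1.
  by apply: countable_lebesgue_measure0; apply: finite_set_countable; exact: finite_set2.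
have [U [oU ZU Ud]] := open_cover_null_small d0 nZ.
have local (s : R) : a <= s <= b -> exists2 r : R, 0 < r & forall y, a <= y <= b ->
    `|y - s| < r -> `|H y - H s| <= e * `|y - s| \/ ball s r `<=` U.
  move=> sab; have [sU|sU] := pselect (U s).
    have /nbhs_ballP[r r0 rU] : nbhs s U by exact: open_nbhs_nbhs.
    by exists r => // y _ _; right.
  have sder : s \in `]a, b[ -> is_derive s 1 H 0.
    by apply: contrapT => ns; apply/sU/ZU; left.
  have sin : s \in `]a, b[.
    have sa : s != a by apply/eqP => sa; apply/sU/ZU; right; left.
    have sb : s != b by apply/eqP => sb; apply/sU/ZU; right; right.
    by case/andP: sab => sa' sb'; rewrite in_itv/= !lt_neqAle sb eq_sym sa sa' sb'.
  have [ds Ds] := sder sin.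
  have := ds; rewrite /derivable => /cvg_ex[l hl].
  have l0 : l = 0 by rewrite -Ds; apply/esym/cvg_lim.
  move: hl; rewrite l0 => /cvgrPdist_le /(_ _ e_gt0).
  rewrite -nbhs_nearE => /nbhs_ballP[r r0 hr]; exists r => // y _ ysr; left.
  have [->|ys] := eqVneq y s; first by rewrite !subrr normr0 mulr0.
  have := hr (y - s); rewrite /ball/= sub0r normrN => /(_ ysr).
  rewrite subr_eq0 => /(_ ys); rewrite sub0r normrN /GRing.scale/= mulr1 subrK.
  by rewrite normrM normfV mulrC ler_pdivrMr// normr_gt0 subr_eq0.
(* P x: the variation between a and x is covered by a slope e and a finite chain of
   disjoint intervals lying in U. *)
pose P x := a <= x <= b /\ exists n (u v : nat -> R),
  [/\ forall i, (i < n)%N -> [/\ a <= u i, u i <= v i & v i <= x],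
      forall i, (i < n)%N -> `]u i, v i[%classic `<=` U,
      forall i j, (i < j < n)%N -> v i <= u j
    & `|H x - H a| <= e * (x - a) + \sum_(i < n) `|H (v i) - H (u i)| ].
have Pa : P a.
  split; first by rewrite lexx.
  exists 0%N, (fun=> 0), (fun=> 0); split => //.
  by rewrite big_ord0 !subrr normr0 mulr0 addr0.
have step (x y : R) : P x -> x <= y -> y <= b ->
    `|H y - H x| <= e * (y - x) \/ `]x, y[%classic `<=` U -> P y.
  move=> [/andP[ax xb] [n [u [v [uv uvU chain Hx]]]]] xy yb xyU.
  have tri : `|H y - H a| <= `|H y - H x| + `|H x - H a|.
    by rewrite -[H y - H a](subrKA (H x)) ler_normD.
  split; first by rewrite yb (le_trans ax).
  case: xyU => xyU.
    exists n, u, v; split => //; last by lra.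
    by move=> i /uv[? ? ?]; split => //; lra.
  exists n.+1, (fun i => if (i < n)%N then u i else x),
    (fun i => if (i < n)%N then v i else y); split.
  - by move=> i _; case: ifP => // /uv[? ? ?]; split => //; lra.
  - by move=> i _; case: ifP => // /uvU.
  - move=> i j /andP[ij jn]; rewrite (leq_trans ij)//; case: ifP => jn'.
      by apply: chain; rewrite ij.
    by have [] := uv i (leq_trans ij jn).
  - rewrite big_ord_recr/= ltnn.
    rewrite (eq_bigr (fun i : 'I_n => `|H (v i) - H (u i)|)).
      have := ltW e_gt0; nra.
    by move=> i _; rewrite ltn_ord.
have sS : has_sup [set x | P x].
  by split; [exists a|exists b => x [/andP[]]].
pose s := sup [set x | P x].
have as_ : a <= s by apply: ub_le_sup => //; case: sS.
have sb : s <= b by apply: ge_sup; [exists a|move=> x [/andP[]]].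
have [r r0 hr] := local s (introT andP (conj as_ sb)).
have Ps : P s.
  (* The local property is used at the right end s of this step, which may not be in S. *)
  have [x Px xs] := sup_adherent r0 sS.
  have xs' : x <= s by apply: ub_le_sup => //; case: sS.
  apply: (step x) => //.
  have [||?|rU] := hr x; first by case: Px.
  - by rewrite distrC ger0_norm; rewrite -/s in xs; lra.
  - left; rewrite distrC -[s - x]ger0_norm ?subr_ge0//.
    by rewrite [in leRHS]distrC.
  - right => y; rewrite /= in_itv/= => /andP[xy ys]; apply: rU.
    rewrite /ball/= ger0_norm; rewrite -/s in xs; lra.
have sb' : s = b.
  apply/eqP; rewrite eq_le sb/= leNgt; apply/negP => sltb.
  pose y := Num.min b (s + r / 2).
  have yb : y <= b by rewrite ge_min lexx.
  have ysr : y <= s + r / 2 by rewrite ge_min lexx orbT.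
  have sy : s < y by rewrite lt_min sltb/= ltrDl divr_gt0.
  suff Py : P y.
    by have : y <= s; [apply: ub_le_sup => //; case: sS|rewrite leNgt sy].
  apply: (step s) => //; first exact: ltW.
  have [||?|rU] := hr y.
  - by apply/andP; split => //; lra.
  - by rewrite ger0_norm; lra.
  - by left; rewrite -[y - s]ger0_norm// subr_ge0 ltW.
  - right => x; rewrite /= in_itv/= => /andP[sx xy]; apply: rU.
    by rewrite /ball/= ler0_norm; lra.
have [_ [n [u [v [uv uvU chain Hb]]]]] := Ps.
rewrite sb' in uv Hb.
apply: (le_trans Hb); rewrite [leRHS]splitr lerD//.
apply/ltW/acd.
- by move=> i; have [] := uv i (ltn_ord i).
- have tI := trivIset_chain chain.
  by move=> i j _ _ ij; apply/val_inj/tI => //=.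
- rewrite -lte_fin (le_lt_trans _ Ud)//; apply: chain_measure => //.
  + exact: open_measurable.
  + by move=> i /uv[].
Qed.

End AC.

Section ACI.
Context {R : realType}.
Notation mu := (@lebesgue_measure R).

Lemma itvNy_Rintegral_sub (g : R -> R) (u v : R) : u <= v ->
  mu.-integrable setT (EFin \o g) ->
  \int[mu]_(t in `]-oo, v]) g t - \int[mu]_(t in `]-oo, u]) g t =
  \int[mu]_(t in `]u, v]) g t.
Proof.
move=> uv ig; rewrite (@Rintegral_itvB _ g -oo%O (BRight v) u)//.
exact: integrableS ig.
Qed.

(** The integral of `|g|` over a set of small measure is small, and the increments at hand
    add up to at most such an integral. *)
Lemma abs_cont_integral (a b : R) (g : R -> R) :
  mu.-integrable setT (EFin \o g) ->
  absolutely_continuous_on a b (fun x => \int[mu]_(t in `]-oo, x]) g t).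
Proof.
move=> ig e e0.
have [d [d0 gd]] := integral_normr_continuous ig e0.
exists d => // n u v uv tI uvd.
pose A := \big[setU/set0]_(i <- index_enum 'I_n) `]u i, v i[%classic.
have mI i : measurable (`]u i, v i[%classic : set R) by [].
have mA : measurable A by exact: bigsetU_measurable.
have muA : (mu A < d%:E)%E.
  apply: le_lt_trans (uvd : ((\sum_(i < n) (v i - u i))%:E < d%:E)%E).
  rewrite /A (measure_semi_additive_ord mu (F := fun i => `]u i, v i[%classic)) //.
  rewrite -sumEFin; apply: lee_sum => i _.
  suff : (lebesgue_measure (`]u i, v i[%classic : set R) <= (v i - u i)%:E)%E by [].
  rewrite lebesgue_measure_itv/= lte_fin; case: ltP => //= vu.
  by have [_ []] := uv i; rewrite lee_fin; lra.
apply: le_lt_trans (gd A mA muA).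
have -> : \int[mu]_(x in A) `|g x| = \sum_(i < n) \int[mu]_(x in `]u i, v i[) `|g x|.
  have ign D : measurable D -> mu.-integrable D (EFin \o (fun x => `|g x|)).
    by move=> mD; apply: integrable_norm; exact: integrableS ig.
  rewrite /Rintegral integral_bigsetU_EFin//=.
  - rewrite (eq_bigr (fun i => (\int[mu]_(x in `]u i, v i[) `|g x|)%:E)) ?sumEFin//.
    by move=> i _; rewrite /Rintegral fineK// integrable_fin_num//; exact: ign.
  - exact: index_enum_uniq.
  - by move=> i j _ _; exact: tI.
  - by have /measurable_int := ign _ mA.
apply: ler_sum => i _; have [au [ui vi]] := uv i.
rewrite itvNy_Rintegral_sub//.
rewrite -Rintegral_itv_bndo_bndc; last exact: integrableS ig.
by apply: le_normr_Rintegral => //; exact: integrableS ig.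
Qed.

Lemma abs_cont_on_sub (a b y : R) (F : R -> R) : y <= b ->
  absolutely_continuous_on a b F -> absolutely_continuous_on a y F.
Proof.
move=> yb acF e /acF[d d0 h]; exists d => // n u v uv.
by apply: h => i; have [? [? ?]] := uv i; split => //; split => //; exact: le_trans yb.
Qed.

Lemma abs_contD (a b : R) (F G : R -> R) :
  absolutely_continuous_on a b F -> absolutely_continuous_on a b G ->
  absolutely_continuous_on a b (fun x => F x + G x).
Proof.
move=> acF acG e e0; have e2 : 0 < e / 2 by rewrite divr_gt0.
have [d d0 hF] := acF _ e2; have [d' d'0 hG] := acG _ e2.
exists (Num.min d d'); first by rewrite lt_min d0.
move=> n u v uv tI; rewrite lt_min => /andP[sd sd'].
have := hF n u v uv tI sd; have := hG n u v uv tI sd'.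
set SG := \sum_(i < n) _; set SF := \sum_(i < n) _ => hSG hSF.
apply: (@le_lt_trans _ _ (SF + SG)); last lra.
rewrite -big_split/=; apply: ler_sum => i _.
have -> : F (v i) + G (v i) - (F (u i) + G (u i)) =
  (F (v i) - F (u i)) + (G (v i) - G (u i)) by ring.
exact: ler_normD.
Qed.

Lemma abs_contM (a b B : R) (F G : R -> R) :
  (forall x, a <= x <= b -> `|F x| <= B) -> (forall x, a <= x <= b -> `|G x| <= B) ->
  absolutely_continuous_on a b F -> absolutely_continuous_on a b G ->
  absolutely_continuous_on a b (fun x => F x * G x).
Proof.
move=> FB GB acF acG e e0.
pose B' := 1 + `|B|; have B'0 : 0 < B' by rewrite ltr_pwDl.
have BB' : B <= B' by rewrite /B' ler_wpDl// ler_norm.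
have e2 : 0 < e / (2 * B') by rewrite divr_gt0// mulr_gt0.
have [d d0 hF] := acF _ e2; have [d' d'0 hG] := acG _ e2.
exists (Num.min d d'); first by rewrite lt_min d0.
move=> n u v uv tI; rewrite lt_min => /andP[sd sd'].
have := hF n u v uv tI sd; have := hG n u v uv tI sd'.
set SG := \sum_(i < n) _; set SF := \sum_(i < n) _ => hSG hSF.
apply: (@le_lt_trans _ _ (B' * (SF + SG))); last first.
  rewrite -ltr_pdivlMl//; have -> : B'^-1 * e = e / (2 * B') + e / (2 * B').
    by field; rewrite gt_eqF.
  lra.
rewrite -big_split/= mulr_sumr; apply: ler_sum => i _.
have [au [ui vi]] := uv i.
have -> : F (v i) * G (v i) - F (u i) * G (u i) =
  (F (v i) - F (u i)) * G (v i) + F (u i) * (G (v i) - G (u i)) by ring.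
apply: (le_trans (ler_normD _ _)); rewrite !normrM mulrDr; apply: lerD.
  rewrite mulrC ler_wpM2r// (le_trans _ BB')// GB//; lra.
by rewrite ler_wpM2r// (le_trans _ BB')// FB//; lra.
Qed.

Lemma abs_cont_lipschitz (a b k : R) (F : R -> R) :
  (forall x y, a <= x -> x <= y -> y <= b -> `|F y - F x| <= k * (y - x)) ->
  absolutely_continuous_on a b F.
Proof.
move=> Fk e e0; pose k' := 1 + `|k|; have k'0 : 0 < k' by rewrite ltr_pwDl.
have kk' : k <= k' by rewrite /k' ler_wpDl// ler_norm.
exists (e / k') => [|n u v uv _]; first by rewrite divr_gt0.
rewrite ltr_pdivlMr// => /(le_lt_trans _); apply.
rewrite mulr_suml; apply: ler_sum => i _; have [au [ui vi]] := uv i.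
rewrite (le_trans (Fk _ _ au ui vi))// mulrC ler_wpM2l//; lra.
Qed.

(** Lebesgue's differentiation theorem makes the difference between F and the primitive of
    g an absolutely continuous function with zero derivative almost everywhere. *)
Lemma abs_cont_FTC (a b : R) (F g : R -> R) :
  absolutely_continuous_on a b F ->
  mu.-integrable setT (EFin \o g) ->
  {ae mu, forall x : R, x \in `]a, b[ -> is_derive x 1 F (g x)} ->
  forall y, a <= y <= b -> F y - F a = \int[mu]_(t in `]a, y]) g t.
Proof.
move=> acF ig dF y /andP[ay yb].
pose I x := \int[mu]_(t in `]-oo, x]) g t.
have := @abs_cont_zero_derivative R a y (fun x => F x + -1 * I x) ay.
rewrite -(itvNy_Rintegral_sub ay ig) -/(I y) -/(I a).
suff [h1 h2] : absolutely_continuous_on a y (fun x => F x + -1 * I x) /\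
  {ae mu, forall x : R, x \in `]a, y[ -> is_derive x 1 (fun x => F x + -1 * I x) 0}.
  by move=> /(_ h1 h2); lra.
split.
  apply: (abs_cont_on_sub yb); apply: abs_contD => //.
  have acI := @abs_cont_integral a b _ ig.
  move=> e /acI[d d0 h]; exists d => // n u v uv tI /(h n u v uv tI).
  apply: le_lt_trans; apply: ler_sum => i _.
  by rewrite -mulrBr normrM normrN1 mul1r.
have igy z : mu.-integrable `]-oo, z] (EFin \o g) by exact: integrableS ig.
have locg : locally_integrable setT g by apply: open_integrable_locally => //; exact: openT.
move: dF (FTC1Ny igy locg); apply: filterS2.
  exact: (ae_filter_ringOfSetsType mu).
move=> x dF [dI I'] xay.
have xab : x \in `]a, b[.
  by move: xay; rewrite !in_itv/= => /andP[-> xy]; exact: lt_le_trans yb.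
have dFx := dF xab.
have dIx : is_derive x 1 I (g x).
  by apply: DeriveDef => //; rewrite -derive1E.
apply: is_derive_eq.
by rewrite /GRing.scale/=; ring.
Qed.
End ACI.

(** * Regularity of the space and square-integrable functions on the unit interval *)

Section K2reg.
Context {R : realType}.
Notation mu := (@lebesgue_measure R).

Lemma within_continuous_eps (a b : R) (f : R -> R) :
  (forall x, a <= x <= b -> forall e, 0 < e -> exists2 d, 0 < d &
     forall y, a <= y <= b -> `|y - x| < d -> `|f y - f x| <= e) ->
  {within `[a, b], continuous f}.
Proof.
move=> h; apply/subspace_continuousP => x /=; rewrite in_itv/= => xab.
apply/cvgrPdist_le => e e0; have [d d0 hd] := h x xab e e0.
rewrite /nbhs/= /within/=; apply/nbhs_ballP; exists d => //= y.
rewrite /ball/= => xyd; rewrite in_itv/= => yab; rewrite distrC.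
by apply: hd => //; rewrite distrC.
Qed.

Lemma within_continuous_bounded (a b : R) (f : R -> R) : a <= b ->
  {within `[a, b], continuous f} ->
  exists B, forall x, a <= x <= b -> `|f x| <= B.
Proof.
move=> ab cf.
have [c _ cmax] := EVT_max ab cf; have [d _ dmin] := EVT_min ab cf.
exists (`|f c| + `|f d|) => x xab.
have := cmax x; have := dmin x; rewrite !in_itv/= => /(_ xab) h1 /(_ xab) h2.
have := ler_norm (f c); have := ler_norm (- f d); rewrite normrN.
have := normr_ge0 (f c); have := normr_ge0 (f d).
rewrite ler_norml; lra.
Qed.

Lemma mvt_lipschitz (a b k : R) (f f' : R -> R) :
  {within `[a, b], continuous f} ->
  (forall x : R, x \in `]a, b[ -> is_derive x 1 f (f' x)) ->
  (forall x, x \in `]a, b[ -> `|f' x| <= k) ->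
  forall x y, a <= x -> x <= y -> y <= b -> `|f y - f x| <= k * (y - x).
Proof.
move=> cf df fk x y ax; rewrite le_eqVlt => /predU1P[<-|xy] yb.
  by rewrite !subrr normr0 mulr0.
have sub z : z \in `]x, y[ -> z \in `]a, b[.
  rewrite !in_itv/= => /andP[xz zy]; apply/andP; split; lra.
have dxy z : z \in `]x, y[ -> is_derive z 1 f (f' z) by move=> /sub; exact: df.
have cxy : {within `[x, y], continuous f}.
  by apply: (continuous_subspaceW _ cf); apply: subset_itv; rewrite bnd_simp.
have [c /sub cxy' E] := MVT xy dxy cxy; rewrite E.
by rewrite normrM (@ger0_norm _ (y - x)) ?ler_wpM2r ?fk//; lra.
Qed.

Lemma abs_cont_within_continuous (a b : R) (f : R -> R) :
  absolutely_continuous_on a b f -> {within `[a, b], continuous f}.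
Proof.
move=> acf; apply: within_continuous_eps => x xab e e0.
have [d d0 hd] := acf e e0; exists d => // y yab yxd.
wlog xy : x y xab yab yxd / x <= y.
  move=> W; have [|/ltW] := leP x y; first exact: W.
  by move=> yx; rewrite distrC W// distrC.
have /= := hd 1%N (fun=> x) (fun=> y); rewrite !big_ord1 => h; apply/ltW/h.
- by move=> _; move: xab yab => /andP[? ?] /andP[? ?].
- by move=> i j _ _ _; rewrite !ord1.
- by move: yxd; rewrite ger0_norm// subr_ge0.
Qed.

(** The difference quotients in the form used below: the one-sided limits at 0 and 1 are
    unpacked once and for all. *)
Lemma has_derivative_on01_eps (f g : R -> R) : has_derivative_on01 f g ->
  forall x, 0 <= x <= 1 -> forall e, 0 < e -> exists2 d, 0 < d &
    forall y, 0 <= y <= 1 -> y != x -> `|y - x| < d ->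
      `|(f y - f x) / (y - x) - g x| <= e.
Proof.
move=> fg x x01 e e0; have := fg x x01.
move=> /cvgrPdist_le /(_ e e0).
rewrite /nbhs/= /within/= /dnbhs/within/=.
move=> /nbhs_ballP[d d0 hd]; exists d => // y y01 yx yxd.
by rewrite distrC; apply: hd; rewrite ?in_itv//= /ball/= distrC.
Qed.

Lemma has_derivative_on01_continuous (f g : R -> R) :
  has_derivative_on01 f g -> {within `[0, 1], continuous f}.
Proof.
move=> fg; apply: within_continuous_eps => x x01 e e0.
have [d d0 hd] := has_derivative_on01_eps fg x01 ltr01.
pose k := 1 + `|g x|; have k0 : 0 < k by rewrite ltr_pwDl.
exists (Num.min d (e / k)) => [|y y01]; first by rewrite lt_min d0 divr_gt0.
rewrite lt_min => /andP[yxd yxe].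
have [->|yx] := eqVneq y x; first by rewrite subrr normr0 ltW.
have := hd y y01 yx yxd => h.
have yx0 : y - x != 0 by rewrite subr_eq0.
have h2 : `|(f y - f x) / (y - x)| <= k.
  rewrite -[X in `|X|](subrK (g x)) (le_trans (ler_normD _ _))//.
  by rewrite lerD2r.
rewrite -[f y - f x](divfK yx0) normrM.
apply: (@le_trans _ _ (k * (e / k))); last by rewrite mulrC divfK// gt_eqF.
by apply: ler_pM => //; exact: ltW.
Qed.

Lemma has_derivative_on01_is_derive (f g : R -> R) :
  has_derivative_on01 f g -> forall x : R, x \in `]0, 1[ -> is_derive x 1 f (g x).
Proof.
move=> fg x; rewrite in_itv/= => /andP[x0 x1].
have x01 : 0 <= x <= 1 by apply/andP; split; lra.
have cv : h^-1 *: ((f \o shift x) (h *: 1) - f x) @[h --> 0^'] --> g x.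
  apply/cvgrPdist_le => e e0.
  have [d d0 hd] := has_derivative_on01_eps fg x01 e0.
  rewrite /nbhs/= /dnbhs/within/=; apply/nbhs_ballP.
  exists (Num.min d (Num.min x (1 - x))) => [/=|h].
    by rewrite !lt_min d0 x0 subr_gt0.
  rewrite /ball/= sub0r normrN !lt_min => /and3P[hd' hx hx1] h0.
  have := hd (h + x); rewrite addrK distrC => hh; rewrite /GRing.scale/= mulr1 mulrC.
  move: hx hx1; rewrite !ltr_norml => /andP[? ?] /andP[? ?].
  apply: hh => //; first by apply/andP; split; lra.
  by rewrite -subr_eq0 addrK.
by apply: DeriveDef; [apply/cvg_ex; exists (g x)|exact/cvg_lim].
Qed.

Lemma near_derive1 (f g : R -> R) (x : R) :
  (forall x : R, x \in `]0, 1[ -> is_derive x 1 f (g x)) -> x \in `]0, 1[ ->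
  \forall y \near x, derive1 f y = g y.
Proof.
move=> dfg x01; have : nbhs x `]0, 1[%classic.
  by apply: open_nbhs_nbhs; split => //; exact: interval_open.
by apply: filterS => y y01; have [_ <-] := dfg y y01; rewrite derive1E.
Qed.


Lemma abs_cont_mvt (a b k : R) (f f' : R -> R) :
  {within `[a, b], continuous f} ->
  (forall x : R, x \in `]a, b[ -> is_derive x 1 f (f' x)) ->
  (forall x, x \in `]a, b[ -> `|f' x| <= k) ->
  absolutely_continuous_on a b f.
Proof. by move=> cf df fk; apply: abs_cont_lipschitz; exact: mvt_lipschitz df fk. Qed.

Lemma in_itvoo01W (x : R) : x \in `]0, 1[ -> 0 <= x <= 1.
Proof. by rewrite in_itv/= => /andP[? ?]; rewrite !ltW. Qed.

(** Packages what integration by parts needs: bounds and absolute continuity for phi and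
    its derivative phi1, and the identification of the iterated [derive1] with the derivative
    of phi1 almost everywhere. *)
Lemma K2_regular (phi : R -> R) : in_K2 phi -> exists phi1 B,
  [/\ forall x, 0 <= x <= 1 -> `|phi x| <= B /\ `|phi1 x| <= B,
      absolutely_continuous_on 0 1 phi, absolutely_continuous_on 0 1 phi1,
      forall x : R, x \in `]0, 1[ -> is_derive x 1 phi (phi1 x)
    & {ae mu, forall x : R, x \in `]0, 1[ -> is_derive x 1 phi1 (derive1n 2 phi x)}].
Proof.
move=> [[phi1 dphi ac1] [dae _]].
have c0 := has_derivative_on01_continuous dphi.
have c1 := abs_cont_within_continuous ac1.
have [B0 hB0] := within_continuous_bounded ler01 c0.
have [B1 hB1] := within_continuous_bounded ler01 c1.
have dphi' := has_derivative_on01_is_derive dphi.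
exists phi1, (Num.max B0 B1); split => //.
- by move=> x x01; rewrite !le_max hB0// hB1// orbT.
- by apply: (abs_cont_mvt c0 dphi') => x /in_itvoo01W; exact: hB1.
- apply: filterS dae; first exact: (ae_filter_ringOfSetsType mu).
  move=> x dx x01; apply: (near_eq_is_derive (near_derive1 dphi' x01)).
  by apply: DeriveDef; [exact: dx|rewrite -derive1E].
Qed.

Local Notation I01 := (`](0 : R), (1 : R)[%classic : set R).

Definition sqint (f : R -> R) := measurable_fun I01 f /\
  mu.-integrable I01 (EFin \o (fun x => f x ^+ 2)).

(** The bound `|f g| <= f^2 + g^2` suffices. *)
Lemma sqintM (f g : R -> R) : sqint f -> sqint g ->
  mu.-integrable I01 (EFin \o (fun x => f x * g x)).
Proof.
move=> [mf f2] [mg g2].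
apply: (@le_integrable _ _ _ mu I01 _ _
  (EFin \o (fun x => f x ^+ 2 + g x ^+ 2))) => //.
- by apply/measurable_EFinP; exact: measurable_funM.
- move=> x _ /=; rewrite lee_fin [leRHS]ger0_norm ?addr_ge0 ?sqr_ge0//.
  by rewrite ler_norml; nra.
- by apply: (integrableD _ f2 g2).
Qed.

Lemma sqint_bounded (f : R -> R) B : measurable_fun I01 f ->
  (forall x, x \in `]0, 1[ -> `|f x| <= B) -> sqint f.
Proof.
move=> mf fB; split => //; apply: measurable_bounded_integrable => //.
- suff : (lebesgue_measure I01 < +oo)%E by [].
  by rewrite lebesgue_measure_itv/= lte_fin ltr01 oppr0 adde0 ltry.
- exact: measurable_funX.
- exists (B ^+ 2); split => [|M BM x /= x01]; first exact: num_real.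
  rewrite normrX (le_trans _ (ltW BM))// lerXn2r ?nnegrE//.
    by rewrite (le_trans _ (fB x x01)).
  exact: fB.
Qed.

Lemma sqintD (f g : R -> R) : sqint f -> sqint g -> sqint (fun x => f x + g x).
Proof.
move=> Lf Lg; split; first exact: measurable_funD Lf.1 Lg.1.
have fg := sqintM Lf Lg.
pose F2 : R -> \bar R := EFin \o (fun x => f x ^+ 2).
pose G2 : R -> \bar R := EFin \o (fun x => g x ^+ 2).
pose FG : R -> \bar R := EFin \o (fun x => f x * g x).
apply: (@eq_integrable _ _ _ mu I01 _ (F2 \+ (FG \+ (FG \+ G2)))%E) => //.
  by move=> x _; rewrite /F2/G2/FG/= -!EFinD; congr EFin; ring.
apply: integrableD => //; first exact: Lf.2.
by apply: integrableD => //; apply: integrableD => //; exact: Lg.2.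
Qed.

Lemma sqintZ (k : R) (f : R -> R) : sqint f -> sqint (fun x => k * f x).
Proof.
move=> [mf f2]; split; first by apply: measurable_funM => //; exact: measurable_cst.
apply: (@eq_integrable _ _ _ mu I01 _
   (fun x => (k ^+ 2)%:E * (f x ^+ 2)%:E)%E) => //.
  by move=> x _ /=; rewrite -EFinM; congr EFin; ring.
exact: integrableZl.
Qed.

Definition inner (f g : R -> R) := \int[mu]_(x in I01) (f x * g x).

Lemma eq_inner (f f' g g' : R -> R) : (forall x, x \in `]0, 1[ -> f x = f' x) ->
  (forall x, x \in `]0, 1[ -> g x = g' x) -> inner f g = inner f' g'.
Proof. by move=> ff gg; apply: eq_Rintegral => x; rewrite inE/= => x01; rewrite ff ?gg. Qed.

Lemma innerC (f g : R -> R) : inner f g = inner g f.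
Proof. by apply: eq_Rintegral => x _; rewrite mulrC. Qed.

Lemma innerDr (f g g' : R -> R) : sqint f -> sqint g -> sqint g' ->
  inner f (fun x => g x + g' x) = inner f g + inner f g'.
Proof.
move=> Lf Lg Lg'; rewrite /inner -RintegralD//; [|exact: sqintM..].
by apply: eq_Rintegral => x _; rewrite mulrDr.
Qed.

Lemma innerZr (f g : R -> R) k : sqint f -> sqint g -> inner f (fun x => k * g x) =
  k * inner f g.
Proof.
move=> Lf Lg; rewrite /inner -RintegralZl//; last exact: sqintM.
by apply: eq_Rintegral => x _; rewrite mulrCA.
Qed.

Lemma inner_ge0 (f : R -> R) : 0 <= inner f f.
Proof. by apply: Rintegral_ge0 => x _; rewrite -expr2 sqr_ge0. Qed.

Lemma inner_expand (f g : R -> R) t : sqint f -> sqint g ->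
  inner (fun x => f x + t * g x) (fun x => f x + t * g x) =
  inner f f + 2 * t * inner f g + t ^+ 2 * inner g g.
Proof.
move=> Lf Lg; have Ltg := sqintZ t Lg; have Ls := sqintD Lf Ltg.
rewrite (innerDr Ls Lf Ltg) (innerZr _ Ls Lg) !(innerC (fun x => _ + _)).
by rewrite !(innerDr _ Lf Ltg)// !(innerZr _ _ Lg)// (innerC g f); ring.
Qed.

(** The discriminant of the nonnegative quadratic t |-> inner (f + t g) (f + t g); a
    vanishing leading coefficient is handled by letting t be large. *)
Lemma cauchy_schwarz (f g : R -> R) : sqint f -> sqint g ->
  inner f g ^+ 2 <= inner f f * inner g g.
Proof.
move=> Lf Lg; have q t := inner_ge0 (fun x => f x + t * g x).
have {}q t : 0 <= inner f f + 2 * t * inner f g + t ^+ 2 * inner g g by rewrite -inner_expand.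
have [g0|g0] := eqVneq (inner g g) 0.
  rewrite g0 mulr0; have := q (- (inner f f + 1) / (2 * inner f g)); rewrite g0 mulr0 addr0.
  have [->|fg0] := eqVneq (inner f g) 0; first by rewrite expr0n.
  have -> : 2 * (- (inner f f + 1) / (2 * inner f g)) * inner f g = - (inner f f + 1) by field.
  lra.
have gp : 0 < inner g g by rewrite lt_def g0 inner_ge0.
have := q (- inner f g / inner g g).
have -> : inner f f + 2 * (- inner f g / inner g g) * inner f g +
  (- inner f g / inner g g) ^+ 2 * inner g g
   = (inner f f * inner g g - inner f g ^+ 2) / inner g g by field.
by rewrite pmulr_lge0 ?invr_gt0// subr_ge0.
Qed.

Lemma sqint_Lfun (f : R -> R) : sqint f -> f \_ I01 \in Lfun mu 2%:E.
Proof.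
move=> [mf f2]; have mI : measurable I01 by [].
have mf' := (measurable_restrictT f mI).1 mf.
rewrite inE; apply/andP; split; rewrite inE//=.
rewrite /finite_norm unlock; apply: poweR_lty.
have [_] := integrableP _ _ _ f2; apply: le_lt_trans.
rewrite [leRHS]integral_mkcond le_eqVlt; apply/orP; left; apply/eqP.
apply: eq_integral => x _.
rewrite /= !patchE; case: ifP => _ /=; last by rewrite normr0 powR0.
by rewrite powR_mulrn// normrX.
Qed.

Lemma Lfun_sqint (f : R -> R) : f \_ I01 \in Lfun mu 2%:E -> sqint f.
Proof.
move=> fL; split.
  move: (fL); rewrite inE => /andP[/[!inE]/= mf _].
  have mI : measurable I01 by [].
  exact: (measurable_restrictT f mI).2 mf.
have := Lfun2_integrable_sqr fL => f2.
apply/(integrable_mkcond _ _).2 => //.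
apply: eq_integrable f2 => // x _ /=; rewrite !patchE; case: ifP => //.
by rewrite expr0n.
Qed.

Definition wave_op omega (phi : R -> R) x := derive1n 2 phi x + omega ^+ 2 * phi x.

Lemma K2_wave_op omega (phi : R -> R) : in_K2 phi -> sqint (wave_op omega phi).
Proof.
move=> K; have [phi1 [B [hB ac0 _ _ _]]] := K2_regular K.
case: K => _ [_ d2]; apply: sqintD; first exact: Lfun_sqint.
apply: sqintZ; apply: (@sqint_bounded _ B) => [|x /in_itvoo01W /hB[]//].
have := abs_cont_within_continuous ac0 => cf.
have mc : measurable_fun (`[(0 : R), (1 : R)]%classic : set R) phi.
  exact: subspace_continuous_measurable_fun.
by apply: measurable_funS mc => //; apply: subset_itv; rewrite bnd_simp.
Qed.

Lemma K2_normE omega (phi : R -> R) :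
  K2_norm omega phi = Num.sqrt (inner (wave_op omega phi) (wave_op omega phi)).
Proof. by []. Qed.
End K2reg.

(** * Variation of constants and the representation of point functionals *)

Section Peano.
Context {R : realType}.
Notation mu := (@lebesgue_measure R).
Local Notation I01 := (`](0 : R), (1 : R)[%classic : set R).
Implicit Types (s : seq (R * R)) (omega : R) (phi : R -> R).

(** The fundamental solution of phi'' + omega^2 phi, written with `|x|` instead of a sign
    so that its continuity is visible. *)
Definition green omega (x : R) := sin (omega * `|x|) / (2 * omega).

Lemma sg_sin omega (x : R) : Num.sg x * sin (omega * x) = sin (omega * `|x|).
Proof.
have [->|x0|x0] := sgrP x; first by rewrite mul0r mulr0 sin0.
  by rewrite mul1r.
by rewrite mulN1r mulrN sinN.
Qed.

Lemma continuous_green omega : continuous (green omega).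
Proof.
move=> x; rewrite /green; apply: cvgM; last exact: cvg_cst.
apply: (@continuous_comp _ _ _ (fun x : R => omega * `|x|) sin); last exact: continuous_sin.
apply: cvgM; first exact: cvg_cst.
exact: norm_continuous.
Qed.

Lemma continuous_sqint (f : R -> R) : continuous f -> sqint f.
Proof.
move=> cf.
have [B hB] := within_continuous_bounded ler01 (continuous_subspaceT cf).
apply: (@sqint_bounded _ _ B) => [|x /in_itvoo01W]; last exact: hB.
by apply: measurable_funS (continuous_measurable_fun cf).
Qed.

Lemma sqint_sum s (k : R -> R -> R) : (forall y, sqint (k y)) ->
  sqint (fun t => \sum_(q <- s) q.1 * k q.2 t).
Proof.
move=> Lk; elim: s => [|q s IH].
  rewrite (_ : (fun t => _) = fun=> 0) ?funeqE; last by move=> t; rewrite big_nil.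
  by apply: continuous_sqint => x; exact: cvg_cst.
rewrite (_ : (fun t => _) = fun t => q.1 * k q.2 t + \sum_(q <- s) q.1 * k q.2 t).
  by apply: sqintD => //; exact: sqintZ.
by rewrite funeqE => t; rewrite big_cons.
Qed.

Lemma inner_sum s (k : R -> R -> R) f : (forall y, sqint (k y)) -> sqint f ->
  inner f (fun t => \sum_(q <- s) q.1 * k q.2 t) = \sum_(q <- s) q.1 * inner f (k q.2).
Proof.
move=> Lk Lf; elim: s => [|q s IH].
  rewrite big_nil (_ : (fun t => _) = fun=> 0) ?funeqE; last by move=> t; rewrite big_nil.
  by rewrite /inner; under eq_Rintegral do rewrite mulr0; rewrite Rintegral_cst// mul0r.
rewrite big_cons -IH -innerZr// -innerDr//; [|exact: sqintZ|exact: sqint_sum].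
by apply: eq_inner => // t _; rewrite big_cons.
Qed.

(** The symmetric Green function corrected by half a sine: this is the kernel of the
    variation-of-constants formula, which vanishes for t beyond y. *)
Definition green_causal omega y t := green omega (y - t) + sin (omega * (y - t)) / (2 * omega).

Lemma green_causalE omega (y t : R) : omega != 0 ->
  green_causal omega y t = if t <= y then sin (omega * (y - t)) / omega else 0.
Proof.
move=> w0; rewrite /green_causal /green; case: leP => ty.
  by rewrite ger0_norm ?subr_ge0//; field.
rewrite ltr0_norm ?subr_lt0// mulrN sinN; ring.
Qed.

Lemma sqint_green omega y : sqint (fun t => green omega (y - t)).
Proof.
apply: continuous_sqint => t; apply: (@continuous_comp _ _ _ (fun t : R => y - t) (green
  omega)).
  by apply: cvgB; [exact: cvg_cst|exact: cvg_id].
exact: continuous_green.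
Qed.

Lemma sqint_sin omega y : sqint (fun t => sin (omega * (y - t)) / (2 * omega)).
Proof.
apply: continuous_sqint => t; apply/differentiable_continuous.
by apply/derivable1_diffP; apply: ex_derive.
Qed.

Lemma sqint_green_causal omega y : sqint (green_causal omega y).
Proof. by apply: sqintD; [exact: sqint_green|exact: sqint_sin]. Qed.

(** A continuous derivative is bounded on [a, b], so f is Lipschitz there. *)
Lemma abs_cont_C1 (a b : R) (f f' : R -> R) : a <= b ->
  (forall x : R, is_derive x 1 f (f' x)) -> continuous f' ->
  absolutely_continuous_on a b f.
Proof.
move=> ab df cf'.
have [B hB] := within_continuous_bounded ab (continuous_subspaceT cf').
apply: (@abs_cont_mvt _ _ _ B _ f') => //.
  by apply: derivable_within_continuous => t _; exact: ex_derive.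
by move=> x; rewrite in_itv/= => /andP[? ?]; apply: hB; rewrite !ltW.
Qed.

Lemma is_derive_continuous (f f' : R -> R) : (forall x : R, is_derive x 1 f (f' x)) ->
  continuous f.
Proof.
by move=> df x; apply/differentiable_continuous/derivable1_diffP; exact: ex_derive.
Qed.

(** Apply the fundamental theorem of calculus on [0, y] to
    t |-> phi(t) cos(omega (y - t)) + phi'(t) sin(omega (y - t)) / omega, whose derivative is
    sin(omega (y - t)) / omega times phi'' + omega^2 phi. *)
Lemma K2_variation_of_constants omega phi : omega != 0 -> in_K2 phi ->
  exists a b, forall y, 0 <= y <= 1 ->
    phi y = a * cos (omega * y) + b * sin (omega * y)
            + inner (green_causal omega y) (wave_op omega phi).
Proof.
move=> w0 Kphi; have [phi1 [B [hB ac0 ac1 d0 d1]]] := K2_regular Kphi.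
have Lphi := K2_wave_op omega Kphi.
exists (phi 0), (phi1 0 / omega) => y y01.
pose c t := cos (omega * (y - t)); pose s t := sin (omega * (y - t)) / omega.
have dc (t : R) : is_derive t 1 c (omega ^+ 2 * s t).
  by apply: is_derive_eq; rewrite /s/GRing.scale/=; field.
have ds (t : R) : is_derive t 1 s (- c t).
  by apply: is_derive_eq; rewrite /c/GRing.scale/=; field.
have [Cc Cs] := (is_derive_continuous dc, is_derive_continuous ds).
have acc : absolutely_continuous_on 0 1 c.
  by apply: abs_cont_C1 dc _ => // t; apply: cvgM; [exact: cvg_cst|exact: Cs].
have acs : absolutely_continuous_on 0 1 s.
  by apply: abs_cont_C1 ds _ => // t; apply: cvgN; exact: Cc.
have [Bc hBc] := within_continuous_bounded ler01 (continuous_subspaceT Cc).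
have [Bs hBs] := within_continuous_bounded ler01 (continuous_subspaceT Cs).
pose B' := Num.max B (Num.max Bc Bs).
(* F y = phi y, while F 0 contributes the trigonometric part. *)
pose F t := phi t * c t + phi1 t * s t.
have acF : absolutely_continuous_on 0 1 F.
  apply: abs_contD; apply: (@abs_contM _ _ _ B') => // x x01; rewrite /B' !le_max.
  - by rewrite (hB _ x01).1.
  - by rewrite hBc ?orbT.
  - by rewrite (hB _ x01).2.
  - by rewrite hBs ?orbT.
pose g := (fun t => s t * wave_op omega phi t) \_ I01.
have mI : measurable I01 by [].
have ig : mu.-integrable setT (EFin \o g).
  have := sqintM (continuous_sqint Cs) Lphi.
  by rewrite integrable_mkcond//= (restrict_EFin (fun t => s t * wave_op omega phi t)).
have dF : {ae mu, forall x : R, x \in `]0, 1[ -> is_derive x 1 F (g x)}.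
  apply: filterS d1; first exact: (ae_filter_ringOfSetsType mu).
  move=> x dphi1 x01; have dphi := d0 x x01; have {}dphi1 := dphi1 x01.
  have := dc x; have := ds x => dsx dcx.
  apply: is_derive_eq.
  rewrite /g patchE mem_set//= /wave_op /GRing.scale/=; ring.
have := abs_cont_FTC acF ig dF y01.
have -> : F y = phi y by rewrite /F/c/s subrr mulr0 cos0 sin0; ring.
have -> : F 0 = phi 0 * cos (omega * y) + phi1 0 / omega * sin (omega * y).
  by rewrite /F/c/s subr0; ring.
move=> E; rewrite -[LHS](subrK (phi 0 * cos (omega * y) + phi1 0 / omega * sin (omega * y))).
rewrite E addrC; congr +%R; rewrite /inner Rintegral_mkcond [RHS]Rintegral_mkcond.
apply: eq_Rintegral => t _; rewrite /g !patchE green_causalE//.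
have [t01|t01] := boolP (t \in I01); last by rewrite if_same.
have t0 : 0 < t by move: t01; rewrite inE/= in_itv/= => /andP[].
rewrite /s; case: leP => ty.
  by rewrite ifT// inE/= in_itv/= t0.
rewrite mul0r ifF//; apply/negbTE; rewrite notin_setE/= in_itv/= t0/=.
by apply/negP; rewrite -ltNge.
Qed.

(** The pairs of s are weights and evaluation points. *)
Definition point_functional s phi := \sum_(q <- s) q.1 * phi q.2.
Definition peano_kernel omega s t := \sum_(q <- s) q.1 * green omega (q.2 - t).

Lemma sqint_peano_kernel omega s : sqint (peano_kernel omega s).
Proof. by apply: (sqint_sum s (k := fun y t => green omega (y - t))) => y;
  exact: sqint_green. Qed.

(** The hypotheses remove the trigonometric part of the variation-of-constants formula, and
    also the half sine by which the causal kernel differs from the symmetric one. *)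
Lemma point_functional_repr omega s phi : omega != 0 ->
  (forall q, q \in s -> 0 <= q.2 <= 1) ->
  point_functional s (fun x => sin (omega * x)) = 0 ->
  point_functional s (fun x => cos (omega * x)) = 0 ->
  in_K2 phi -> point_functional s phi = inner (peano_kernel omega s) (wave_op omega phi).
Proof.
move=> w0 s01 ssin scos Kphi; have [a [b E]] := K2_variation_of_constants w0 Kphi.
have Lphi := K2_wave_op omega Kphi.
have -> : point_functional s phi = a * point_functional s (fun x => cos (omega * x)) +
    b * point_functional s (fun x => sin (omega * x)) +
      inner (wave_op omega phi) (fun t => \sum_(q <- s) q.1 * green_causal omega q.2 t).
  rewrite inner_sum//; last by move=> y; exact: sqint_green_causal.
  rewrite /point_functional !mulr_sumr -!big_split/= big_seq [RHS]big_seq.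
  apply: eq_bigr => q qs; rewrite E ?s01// innerC; ring.
rewrite ssin scos !mulr0 !add0r innerC; apply: eq_inner => // t _.
rewrite /peano_kernel; apply/eqP; rewrite -subr_eq0 -sumrB; apply/eqP.
transitivity (cos (omega * t) / (2 * omega) * point_functional s (fun x => sin (omega * x)) -
    sin (omega * t) / (2 * omega) * point_functional s (fun x => cos (omega * x))).
  rewrite /point_functional !mulr_sumr -sumrB; apply: eq_bigr => q _.
  rewrite /green_causal mulrBr sinB; ring.
by rewrite ssin scos; ring.
Qed.

Lemma C2_in_K2 (f f1 f2 : R -> R) : (forall x : R, is_derive x 1 f (f1 x)) ->
  (forall x : R, is_derive x 1 f1 (f2 x)) -> continuous f2 ->
  in_K2 f /\ forall x, derive1n 2 f x = f2 x.
Proof.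
move=> df df1 cf2.
have E1 : derive1 f = f1 by apply/funext => x; rewrite derive1E; have [_ ->] := df x.
have E2 : derive1n 2 f = f2.
  rewrite /derive1n/= -/(derive1 f) E1; apply/funext => x.
  by rewrite derive1E; have [_ ->] := df1 x.
split; last by move=> x; rewrite E2.
split; [exists f1|split].
- move=> x x01; have [/cvg_ex[l hl] fl] := df x.
  have ll : l = f1 x by rewrite -fl; apply/esym/cvg_lim.
  rewrite {l}ll in hl; move/cvgrPdist_le : hl => hl.
  apply/cvgrPdist_le => e e0; have := hl e e0.
  rewrite /nbhs/= /dnbhs/within/= => /nbhs_ballP[d d0 hd].
  apply/nbhs_ballP; exists d => // y xy yx y01.
  have := hd (y - x); rewrite /ball/= sub0r normrN distrC => /(_ xy).
  by rewrite subr_eq0 => /(_ yx); rewrite /GRing.scale/= mulr1 subrK mulrC.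
- exact: abs_cont_C1 df1 _.
- by rewrite E1; apply: aeW => x _; apply: ex_derive.
- by rewrite E2; apply: sqint_Lfun; exact: continuous_sqint.
Qed.

End Peano.

(** * Interpolating splines *)

Section Splines.
Context {R : realType}.
Implicit Types (s : seq (R * R)) (omega : R) (phi : R -> R).

(** At 0 the quotient has the same norm as that of f, up to a sign, hence tends to 0. *)
Lemma is_derive_sg (f f' : R -> R) : (forall x : R, is_derive x 1 f (f' x)) ->
  f 0 = 0 -> f' 0 = 0 ->
  forall x : R, is_derive x 1 (fun x => Num.sg x * f x) (Num.sg x * f' x).
Proof.
move=> df f0 f'0 x; have dfx := df x.
have [x0|x0|->] := ltgtP x 0; last first.
- have [/cvg_ex[l hl] fl] := df 0.
  have ll : l = 0 by rewrite -f'0 -fl; apply/esym/cvg_lim.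
  rewrite {l}ll in hl; rewrite f'0 mulr0.
  suff cv : h^-1 *: (((fun x => Num.sg x * f x) \o shift 0) (h *: 1) -
      Num.sg 0 * f 0) @[h --> 0^'] --> (0 : R).
    by apply: DeriveDef; [apply/cvg_ex; exists 0|exact/cvg_lim].
  move/cvgrPdist_le : hl => hl; apply/cvgrPdist_le => e e0.
  apply: filterS (hl e e0) => h; rewrite /= !sub0r !normrN f0 !subr0 sgr0 mul0r subr0.
  rewrite /GRing.scale/= mulr1 addr0 !normrM; apply: le_trans.
  rewrite ler_wpM2l// -[leRHS]mul1r ler_wpM2r// normr_sg.
  by case: (h != 0).
- have px : \forall y \near x, f y = Num.sg y * f y.
    by near=> y; rewrite gtr0_sg ?mul1r//; near: y; exact: lt_nbhsr.
  by rewrite gtr0_sg// mul1r; exact: near_eq_is_derive px dfx.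
- have px : \forall y \near x, - f y = Num.sg y * f y.
    by near=> y; rewrite ltr0_sg ?mulN1r//; near: y; exact: lt_nbhsl.
  rewrite ltr0_sg// mulN1r; apply: (near_eq_is_derive px).
Unshelve. all: by end_near. Qed.

Lemma is_derive_lin_comb s (k k' : R -> R -> R) (x : R) :
  (forall y, is_derive x 1 (k y) (k' y x)) ->
  is_derive x 1 (fun x => \sum_(q <- s) q.1 * k q.2 x) (\sum_(q <- s) q.1 * k' q.2 x).
Proof.
move=> dk; elim: s => [|q s IH].
  rewrite (_ : (fun x => _) = cst 0); last by apply/funext => t; rewrite big_nil.
  by rewrite big_nil; exact: is_derive_cst.
rewrite (_ : (fun x => _) = fun x => q.1 * k q.2 x + \sum_(q <- s) q.1 * k q.2 x); last first.
  by apply/funext => t; rewrite big_cons.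
have dkq := dk q.2.
by apply: is_derive_eq; rewrite big_cons /GRing.scale/= addrC; ring.
Qed.

Definition dG2 omega (x : R) := Num.sg x * (x * sin (omega * x) / (4 * omega)).
Definition d2G2 omega (x : R) :=
  Num.sg x * ((sin (omega * x) + omega * x * cos (omega * x)) / (4 * omega)).

Lemma is_derive_G2 omega (x : R) : omega != 0 -> is_derive x 1 (G2 omega) (dG2 omega x).
Proof.
move=> w0.
have -> : G2 omega = fun x => Num.sg x *
    ((sin (omega * x) - omega * x * cos (omega * x)) / (4 * omega ^+ 3)).
  by apply/funext => t; rewrite /G2; ring.
rewrite /dG2; pose f (x : R) := (sin (omega * x) - omega * x * cos (omega * x)) / (4 *
  omega ^+ 3).
have df (t : R) : is_derive t 1 f (t * sin (omega * t) / (4 * omega)).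
  by apply: is_derive_eq; rewrite /GRing.scale/=; field.
by apply: (is_derive_sg df); rewrite /f ?mulr0 ?sin0 ?mul0r// subr0 mul0r.
Qed.

Lemma is_derive_dG2 omega (x : R) : omega != 0 -> is_derive x 1 (dG2 omega) (d2G2 omega x).
Proof.
move=> w0; rewrite /dG2 /d2G2; pose f (x : R) := x * sin (omega * x) / (4 * omega).
have df (t : R) : is_derive t 1 f ((sin (omega * t) +
  omega * t * cos (omega * t)) / (4 * omega)).
  by apply: is_derive_eq; rewrite /GRing.scale/=; field.
by apply: (is_derive_sg df); rewrite /f ?mulr0 ?sin0 ?mul0r// addr0 mul0r.
Qed.

(** G2 is a fundamental solution of the squared operator: applying the operator once leaves
    the Green function. *)
Lemma d2G2E omega (x : R) : omega != 0 ->
  d2G2 omega x + omega ^+ 2 * G2 omega x = green omega x.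
Proof.
by move=> w0; rewrite /d2G2 /G2 /green -sg_sin; field.
Qed.

Lemma G2N omega (x : R) : G2 omega (- x) = G2 omega x.
Proof. by rewrite /G2 mulrN sinN cosN sgrN; ring. Qed.

Definition spline omega s a b (x : R) := \sum_(q <- s) q.1 * G2 omega (x - q.2) +
  a * sin (omega * x) + b * cos (omega * x).

(** The second derivative is exposed because the semi-norm is computed from it; the first
    one is only needed to link the two. *)
Definition C2_with (f f2 : R -> R) := exists f1 : R -> R,
  [/\ forall x : R, is_derive x 1 f (f1 x), forall x : R, is_derive x 1 f1 (f2 x)
    & continuous f2].

Lemma C2_with_K2 (f f2 : R -> R) : C2_with f f2 ->
  in_K2 f /\ forall x, derive1n 2 f x = f2 x.
Proof. by move=> [f1 [d1 d2 c2]]; exact: C2_in_K2 d1 d2 c2. Qed.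

Lemma C2_with_lin (f f2 g g2 : R -> R) t : C2_with f f2 -> C2_with g g2 ->
  C2_with (fun x => f x + t * g x) (fun x => f2 x + t * g2 x).
Proof.
move=> [f1 [df1 df2 cf2]] [g1 [dg1 dg2 cg2]].
exists (fun x => f1 x + t * g1 x); split => x.
- have := df1 x; have := dg1 x => dg df.
  by apply: is_derive_eq; rewrite /GRing.scale/=; ring.
- have := df2 x; have := dg2 x => dg df.
  by apply: is_derive_eq; rewrite /GRing.scale/=; ring.
- by apply: cvgD; [exact: cf2|apply: cvgM; [exact: cvg_cst|exact: cg2]].
Qed.

Lemma C2_wave_op omega (f f2 : R -> R) : C2_with f f2 ->
  forall x, wave_op omega f x = f2 x + omega ^+ 2 * f x.
Proof. by move=> /C2_with_K2[_ E] x; rewrite /wave_op E. Qed.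

Lemma C2_with_poly (p : {poly R}) : C2_with (horner p) (horner p^`()^`()).
Proof.
exists (horner p^`()); split=> x; [exact: is_derive_poly..|].
exact/differentiable_continuous/derivable1_diffP/derivable_horner.
Qed.

(** The second derivative of G2 is read off from the continuous Green function, so the
    spline is of class C^2 in spite of the signs in G2. *)
Lemma spline_C2 omega s a b : omega != 0 ->
  C2_with (spline omega s a b)
    (fun x => peano_kernel omega s x - omega ^+ 2 * spline omega s a b x).
Proof.
move=> w0.
pose f1 x := \sum_(q <- s) q.1 * dG2 omega (x - q.2) +
  a * omega * cos (omega * x) - b * omega * sin (omega * x).
pose f2 x := peano_kernel omega s x - omega ^+ 2 * spline omega s a b x.
have dG y (x : R) : is_derive x 1 (fun x => G2 omega (x - y)) (dG2 omega (x - y)).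
  have h := is_derive_G2 (x - y) w0.
  rewrite -[dG2 _ _]mulr1; apply: (is_derive1_comp (f := G2 omega) (g := fun x => x - y)).
  by apply: is_derive_eq; rewrite subr0.
have ddG y (x : R) : is_derive x 1 (fun x => dG2 omega (x - y)) (d2G2 omega (x - y)).
  have h := is_derive_dG2 (x - y) w0.
  rewrite -[d2G2 _ _]mulr1; apply: (is_derive1_comp (f := dG2 omega) (g := fun x => x - y)).
  by apply: is_derive_eq; rewrite subr0.
have d1 (x : R) : is_derive x 1 (spline omega s a b) (f1 x).
  have h := @is_derive_lin_comb s _ (fun y x => dG2 omega (x - y)) x (fun y => dG y x).
  by apply: is_derive_eq; rewrite /f1 /GRing.scale/=; ring.
have d2 (x : R) : is_derive x 1 f1 (f2 x).
  have h := @is_derive_lin_comb s _ (fun y x => d2G2 omega (x - y)) x (fun y => ddG y x).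
  apply: is_derive_eq; rewrite /f2 /spline /peano_kernel /GRing.scale/=.
  have -> : \sum_(q <- s) q.1 * green omega (q.2 - x) = \sum_(q <- s) q.1 * d2G2 omega (x - q.2)
     + omega ^+ 2 * \sum_(q <- s) q.1 * G2 omega (x - q.2).
    rewrite mulr_sumr -big_split/=; apply: eq_bigr => q _.
    rewrite (_ : green omega (q.2 - x) = d2G2 omega (x - q.2) +
      omega ^+ 2 * G2 omega (x - q.2)).
      by ring.
    by rewrite d2G2E// /green distrC.
  by ring.
have cker : continuous (peano_kernel omega s).
  rewrite /peano_kernel; elim: s {f1 f2 d1 d2} => [|q s IH] x.
    rewrite (_ : (fun t => _) = cst 0); last by apply/funext => t; rewrite big_nil.
    exact: cvg_cst.
  rewrite (_ : (fun t => _) = fun t => q.1 * green omega (q.2 - t) +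
    \sum_(q <- s) q.1 * green omega (q.2 - t)); last first.
    by apply/funext => t; rewrite big_cons.
  apply: cvgD; last exact: IH.
  apply: cvgM; first exact: cvg_cst.
  apply: (@continuous_comp _ _ _ (fun t : R => q.2 - t) (green omega)).
    by apply: cvgB; [exact: cvg_cst|exact: cvg_id].
  exact: continuous_green.
have cf2 : continuous f2.
  move=> x; apply: cvgB; first exact: cker.
  by apply: cvgM; [exact: cvg_cst|exact: is_derive_continuous d1 x].
by exists f1.
Qed.

Lemma spline_wave_op omega s a b x : omega != 0 ->
  wave_op omega (spline omega s a b) x = peano_kernel omega s x.
Proof. by move=> w0; rewrite (C2_wave_op _ (spline_C2 _ _ _ w0)) subrK. Qed.
End Splines.

(** * Optimality and uniqueness *)

Section Optimal.
Context {R : realType} (omega z : R) (N : nat).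
Hypotheses (w0 : omega != 0) (Npos : (1 <= N)%N) (z01 : 0 <= z <= 1).
Local Notation x_ i := (step R N * (i : nat)%:R).
Implicit Types (c : 'I_N.+1 -> R).

Lemma step_gt0 : 0 < step R N. Proof. by rewrite invr_gt0 ltr0n. Qed.

Lemma node01 (i : 'I_N.+1) : 0 <= x_ i <= 1.
Proof.
rewrite mulr_ge0 ?ler0n ?(ltW step_gt0)//= /step mulrC ler_pdivrMr ?ltr0n// mul1r.
by rewrite ler_nat -ltnS.
Qed.

Lemma node_inj (i j : 'I_N.+1) : x_ i = x_ j -> i = j.
Proof.
move=> /(mulfI (lt0r_neq0 step_gt0)) /eqP; rewrite eqr_nat => /eqP.
exact: val_inj.
Qed.

Definition weight_terms c : seq (R * R) := [seq (c i, x_ i) | i <- index_enum 'I_N.+1].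
Definition error_terms c : seq (R * R) := (1, z) :: weight_terms (fun i => - c i).

Lemma point_functional_weight c phi :
  point_functional (weight_terms c) phi = \sum_i c i * phi (x_ i).
Proof. by rewrite /point_functional big_map. Qed.

Lemma point_functional_error c phi :
  point_functional (error_terms c) phi = error_functional z c phi.
Proof.
rewrite /point_functional big_cons -/(point_functional _ _) point_functional_weight mul1r
  /error_functional -sumrN.
by congr +%R; apply: eq_bigr => i _; rewrite mulNr.
Qed.

Lemma weight_terms01 c q : q \in weight_terms c -> 0 <= q.2 <= 1.
Proof. by case/mapP => i _ ->; exact: node01. Qed.

Lemma error_terms01 c q : q \in error_terms c -> 0 <= q.2 <= 1.
Proof. by rewrite inE => /predU1P[->//|]; exact: weight_terms01. Qed.

(** Test with the product of the X - x_j over the other nodes. *)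
Lemma poly_separates c : (forall p : {poly R}, \sum_i c i * p.[x_ i] = 0) ->
  forall i, c i = 0.
Proof.
move=> h i; have := h (\prod_(j < N.+1 | j != i) ('X - (x_ j)%:P)).
rewrite (bigD1 i)//= [X in _ + X]big1 ?addr0 => [/eqP|j ji].
  rewrite mulf_eq0 => /orP[/eqP//|]; rewrite horner_prod.
  move/prodf_eq0 => [j ji]; rewrite !hornerE subr_eq0 => /eqP/node_inj ij.
  by rewrite ij eqxx in ji.
by rewrite horner_prod (bigD1 j)//= hornerXsubC subrr mul0r mulr0.
Qed.

Lemma error_repr c phi :
  error_functional z c (fun x => sin (omega * x)) = 0 ->
  error_functional z c (fun x => cos (omega * x)) = 0 -> in_K2 phi ->
  error_functional z c phi = inner (peano_kernel omega (error_terms c)) (wave_op omega phi).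
Proof.
rewrite -!point_functional_error => hs hc K; apply: point_functional_repr => //;
  exact: error_terms01.
Qed.

Lemma error_le c phi :
  error_functional z c (fun x => sin (omega * x)) = 0 ->
  error_functional z c (fun x => cos (omega * x)) = 0 -> in_K2 phi ->
  `|error_functional z c phi| <=
    Num.sqrt (inner (peano_kernel omega (error_terms c)) (peano_kernel omega (error_terms
      c))) * K2_norm omega phi.
Proof.
move=> hs hc K; rewrite K2_normE -sqrtrM ?inner_ge0// -sqrtr_sqr ler_wsqrtr//.
by rewrite error_repr//; apply: cauchy_schwarz; [exact: sqint_peano_kernel|exact: K2_wave_op].
Qed.

(** The stationarity conditions of the quadratic minimisation problem: the two exactness
    constraints, and the vanishing of the representer of the error functional at all nodes,
    where a and b play the role of Lagrange multipliers. *)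
Definition spline_system c a b := [/\
  error_functional z c (fun x => sin (omega * x)) = 0,
  error_functional z c (fun x => cos (omega * x)) = 0 &
  forall i : 'I_N.+1, spline omega (error_terms c) a b (x_ i) = 0].

Section opt.
Variables (c : 'I_N.+1 -> R) (a b : R).
Hypothesis ci : spline_system c a b.
Let u := peano_kernel omega (error_terms c).
Let P := spline omega (error_terms c) a b.

(** The representer vanishes at the nodes, so the weights do not contribute; with the
    weights c the value is its squared norm. *)
Lemma error_spline c' : error_functional z c' P = inner u u.
Proof.
have [hs hc h0] := ci.
have E c1 : error_functional z c1 P = P z.
  by rewrite /error_functional big1 ?subr0// => i _; rewrite /P h0 mulr0.
rewrite E -(E c) error_repr//; last exact: (C2_with_K2 (spline_C2 _ _ _ w0)).1.
by apply: eq_inner => // x _; exact: spline_wave_op.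
Qed.

Lemma spline_norm : K2_norm omega P = Num.sqrt (inner u u).
Proof. by rewrite K2_normE; congr Num.sqrt; apply: eq_inner => x _; exact: spline_wave_op. Qed.

Lemma error_norm_le : (error_norm omega z c <= (Num.sqrt (inner u u))%:E)%E.
Proof.
have [hs hc _] := ci; apply: ge_ereal_sup => _ [phi [K n0] <-].
rewrite lee_fin ler_pdivrMr; first exact: error_le.
by rewrite lt_def n0 sqrtr_ge0.
Qed.

Lemma error_norm_ub c' phi : in_K2 phi -> K2_norm omega phi != 0 ->
  ((`|error_functional z c' phi| / K2_norm omega phi)%:E <= error_norm omega z c')%E.
Proof. by move=> K n0; apply: ereal_sup_ubound; exists phi. Qed.

(** The constant function 1 is in the space and has nonzero semi-norm, so the supremum
    ranges over a nonempty set. *)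
Lemma error_norm_ge0 c' : (0 <= error_norm omega z c')%E.
Proof.
have [K D] := C2_with_K2 (C2_with_poly (1 : {poly R})).
suff n0 : K2_norm omega (horner 1) != 0.
  by apply: le_trans (error_norm_ub c' K n0); rewrite lee_fin divr_ge0// sqrtr_ge0.
rewrite K2_normE sqrtr_eq0 -ltNge /inner.
rewrite (_ : Rintegral _ _ _ = \int[@lebesgue_measure R]_(x in `]0%R, 1%R[%classic) (omega
  ^+ 4)).
  rewrite Rintegral_cst//.
  rewrite (_ : fine _ = 1) ?mulr1 ?exprn_even_gt0 ?w0//.
  suff : fine (lebesgue_measure (`]0%R, 1%R[%classic : set R)) = 1 by [].
  by rewrite lebesgue_measure_itv/= lte_fin ltr01 oppr0 adde0.
apply: eq_Rintegral => x _; rewrite (C2_wave_op _ (C2_with_poly (1 : {poly R}))) derivC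
  deriv0 horner0.
have -> : (1 : {poly R}).[x] = 1 by rewrite -polyC1 hornerC.
by ring.
Qed.

(** Cauchy-Schwarz bounds the norm for c from above by the semi-norm of the representer;
    the value at the representer bounds every other norm from below by the same number. *)
Lemma spline_system_optimal : optimal_coefficients omega z c.
Proof.
have [hs hc _] := ci; split => // c'; apply: (le_trans error_norm_le).
have [I0|I0] := eqVneq (inner u u) 0; first by rewrite I0 sqrtr0 error_norm_ge0.
have Ip : 0 < inner u u by rewrite lt_def I0 inner_ge0.
have KP := (C2_with_K2 (spline_C2 (error_terms c) a b w0)).1.
have n0 : K2_norm omega P != 0 by rewrite spline_norm sqrtr_eq0 -ltNge.
apply: le_trans (error_norm_ub c' KP n0); rewrite -/P spline_norm.
rewrite lee_fin error_spline (ger0_norm (ltW Ip)) ler_pdivlMr ?sqrtr_gt0//.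
by rewrite -expr2 sqr_sqrtr// ltW.
Qed.

(** If c' is optimal too, the norm of its error functional is attained at the representer P.
    The first-order condition along P + t p says that both functionals agree on every
    polynomial p, and polynomials separate the nodes. *)
Lemma optimal_unique c' : optimal_coefficients omega z c' -> c' =1 c.
Proof.
move=> [hs' hc' opt]; have [hs hc h0] := ci.
suff E (p : {poly R}) : error_functional z c' (horner p) = error_functional z c (horner p).
  move=> i; apply/eqP; rewrite -subr_eq0; apply/eqP.
  apply: (poly_separates (c := fun i => c' i - c i)) => p.
  have := E p; rewrite /error_functional => /addrI/oppr_inj H.
  by rewrite -[RHS](subrr (\sum_i c i * p.[x_ i])) -{1}H -sumrB; apply: eq_bigr => j _; ring.
have C1 := spline_C2 (error_terms c) a b w0; have C2 := C2_with_poly p.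
have [Kp _] := C2_with_K2 C2.
have Lp := K2_wave_op omega Kp.
have Lu : sqint u := sqint_peano_kernel omega (error_terms c).
have bound phi : in_K2 phi ->
    `|error_functional z c' phi| <= Num.sqrt (inner u u) * K2_norm omega phi.
  move=> K; have [n0|n0] := eqVneq (K2_norm omega phi) 0.
    by have := error_le hs' hc' K; rewrite n0 !mulr0.
  have := le_trans (error_norm_ub c' K n0) (le_trans (opt c) error_norm_le).
  by rewrite lee_fin ler_pdivrMr// lt_def n0 sqrtr_ge0.
pose e' := error_functional z c' (horner p).
(* Squared form of the bound by the norm, at the perturbation P + t p. *)
have key t : (inner u u + t * e') ^+ 2 <=
    inner u u * (inner u u + 2 * t * inner u (wave_op omega (horner p)) +
              t ^+ 2 * inner (wave_op omega (horner p)) (wave_op omega (horner p))).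
  have Ct := C2_with_lin t C1 C2; have [Kt _] := C2_with_K2 Ct.
  have := bound _ Kt; rewrite K2_normE.
  have -> : inner (wave_op omega (fun x => spline omega (error_terms c) a b x + t * p.[x]))
      (wave_op omega (fun x => spline omega (error_terms c) a b x + t * p.[x])) =
      inner (fun x => u x + t * wave_op omega (horner p) x) (fun x => u x +
        t * wave_op omega (horner p) x).
    have EE x : wave_op omega (fun x => spline omega (error_terms c) a b x + t * p.[x]) x =
        u x + t * wave_op omega (horner p) x.
      by rewrite (C2_wave_op _ Ct) (C2_wave_op _ C2) -/u -/P; ring.
    by apply: eq_inner => x _.
  rewrite inner_expand//.
  have -> : error_functional z c' (fun x => spline omega (error_terms c) a b x + t * p.[x]) =
      inner u u + t * e'.
    rewrite -(error_spline c') /e' /error_functional.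
    have -> : \sum_(i < N.+1) c' i * (spline omega (error_terms c) a b (x_ i) + t * p.[x_ i]) =
        \sum_(i < N.+1) c' i * P (x_ i) + t * \sum_(i < N.+1) c' i * p.[x_ i].
      by rewrite mulr_sumr -big_split/=; apply: eq_bigr => i _; rewrite -/P; ring.
    by rewrite -/P; ring.
  rewrite -sqrtrM ?inner_ge0// -sqrtr_sqr ler_sqrt ?mulr_ge0 ?inner_ge0//.
  by rewrite -inner_expand// inner_ge0.
rewrite [RHS]error_repr// -/u -/e'.
set I := inner u u in key *; set d := inner u _ in key *; set n := inner (wave_op _ _) _ in key.
have I_ge0 : 0 <= I := inner_ge0 u.
have n_ge0 : 0 <= n := inner_ge0 _.
have CS : d ^+ 2 <= I * n := cauchy_schwarz Lu Lp.
have [I0|I0] := eqVneq I 0.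
  have := key 1; rewrite I0 !mul0r add0r mul1r => h1.
  rewrite I0 mul0r in CS.
  have /eqP : e' ^+ 2 == 0 by rewrite eq_le h1 sqr_ge0.
  have /eqP : d ^+ 2 == 0 by rewrite eq_le CS sqr_ge0.
  by move=> /eqP; rewrite sqrf_eq0 => /eqP-> /eqP; rewrite sqrf_eq0 => /eqP->.
have Ip : 0 < I by rewrite lt_def I0.
apply/eqP; rewrite -subr_eq0; apply/eqP.
(* The inequality is 2 t I (e' - d) <= t^2 (I n - e'^2). K is a positive bound of the last
   factor, and t = I (e' - d) / K makes the left side dominate. *)
pose K := 1 + `|I * n - e' ^+ 2|.
have K0 : 0 < K by rewrite ltr_pwDl.
have Kn : I * n - e' ^+ 2 <= K by rewrite (le_trans (ler_norm _))// lerDr.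
pose D := e' - d; have {}key t : 2 * t * I * D <= t ^+ 2 * K.
  have := key t; have : t ^+ 2 * (I * n - e' ^+ 2) <= t ^+ 2 * K.
    by rewrite ler_wpM2l// sqr_ge0.
  rewrite /D; nra.
have := key (I * D / K).
have -> : 2 * (I * D / K) * I * D = 2 * (I * D) ^+ 2 / K by field; rewrite gt_eqF.
have -> : (I * D / K) ^+ 2 * K = (I * D) ^+ 2 / K by field; rewrite gt_eqF.
rewrite ler_pM2r ?invr_gt0// => h.
have : (I * D) ^+ 2 <= 0 by lra.
move=> h2; have /eqP : (I * D) ^+ 2 == 0 by rewrite eq_le h2 sqr_ge0.
by move=> /eqP; rewrite sqrf_eq0 mulf_eq0 (negbTE I0)/= => /eqP.
Qed.
End opt.
End Optimal.

(** * Solvability of the interpolation system *)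

Section Exists.
Context {R : realType} (omega z : R) (N : nat).
Hypotheses (w0 : omega != 0) (Npos : (1 <= N)%N).
Hypothesis sinh : sin (omega * step R N) != 0.
Local Notation x_ i := (step R N * (i : nat)%:R).
Implicit Types (c : 'I_N.+1 -> R).

Lemma spline_weight c a b x : spline omega (weight_terms c) a b x =
  \sum_j c j * G2 omega (x - x_ j) + a * sin (omega * x) + b * cos (omega * x).
Proof. by rewrite /spline big_map. Qed.

Lemma spline_error c a b x : spline omega (error_terms z c) a b x =
  G2 omega (z - x) - \sum_j c j * G2 omega (x - x_ j)
  + a * sin (omega * x) + b * cos (omega * x).
Proof.
rewrite /spline big_cons big_map mul1r -(G2N omega (z - x)) opprB -sumrN.
by do 3 congr +%R; apply: eq_bigr => j _; rewrite mulNr.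
Qed.

(** With u the kernel of the functional of weights c, the value of that functional at its
    own spline is int u^2; it is 0 since the spline vanishes at the nodes. So it
    vanishes on polynomials, which gives c = 0; then a and b
    are read off at the first two nodes. *)
Lemma homogeneous_trivial c a b :
  \sum_i c i * sin (omega * x_ i) = 0 -> \sum_i c i * cos (omega * x_ i) = 0 ->
  (forall i : 'I_N.+1, spline omega (weight_terms c) a b (x_ i) = 0) ->
  [/\ forall i, c i = 0, a = 0 & b = 0].
Proof.
move=> hs hc h0; have KP := (C2_with_K2 (spline_C2 (weight_terms c) a b w0)).1.
have rep phi : in_K2 phi -> \sum_i c i * phi (x_ i) =
    inner (peano_kernel omega (weight_terms c)) (wave_op omega phi).
  move=> K; rewrite -(point_functional_weight c phi); apply: point_functional_repr => //.
  - exact: weight_terms01.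
  - by rewrite point_functional_weight.
  - by rewrite point_functional_weight.
have I0 : inner (peano_kernel omega (weight_terms c)) (peano_kernel omega (weight_terms c)) = 0.
  rewrite -[LHS](_ : inner (peano_kernel omega (weight_terms c)) (wave_op omega (spline
    omega (weight_terms c) a b)) = _).
    by rewrite -rep// big1// => i _; rewrite h0 mulr0.
  by apply: eq_inner => // x _; exact: spline_wave_op.
have c0 : forall i, c i = 0.
  apply: poly_separates => // p; have [Kp _] := C2_with_K2 (C2_with_poly p).
  rewrite rep//.
  have := cauchy_schwarz (sqint_peano_kernel omega (weight_terms c)) (K2_wave_op omega Kp).
  rewrite I0 mul0r => h; apply/eqP; rewrite -sqrf_eq0 eq_le h sqr_ge0; by [].
have E (i : 'I_N.+1) : a * sin (omega * x_ i) + b * cos (omega * x_ i) = 0.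
  have := h0 i; rewrite spline_weight big1 ?add0r// => j _.
  by rewrite c0 mul0r.
have b0 : b = 0.
  by have := E ord0; rewrite /= !mulr0 sin0 cos0 mulr0 mulr1 add0r.
split => //; have := E (inord 1); rewrite inordK ?ltnS// mulr1 b0 mul0r addr0.
by move/eqP; rewrite mulf_eq0 (negbTE sinh) orbF => /eqP.
Qed.

(** The system is linear and square, with a bordered symmetric matrix, and its kernel is
    trivial. *)
Lemma spline_system_exists : exists c a b, spline_system omega z c a b.
Proof.
pose G : 'M[R]_N.+1 := \matrix_(i, j) G2 omega (x_ i - x_ j).
pose S : 'M[R]_(N.+1, 2) := \matrix_(i, k)
  if k == 0 then sin (omega * x_ i) else cos (omega * x_ i).
pose M := block_mx G S S^T 0.
have GE (c : 'cV[R]_N.+1) (d : 'cV[R]_2) i : (G *m c + S *m d) i 0 =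
    \sum_j c j 0 * G2 omega (x_ i - x_ j) + d 0 0 * sin (omega * x_ i) +
      d 1 0 * cos (omega * x_ i).
  rewrite !mxE -addrA; congr +%R; first by apply: eq_bigr => j _; rewrite mxE mulrC.
  by rewrite big_ord_recl big_ord1 !mxE/= ![d _ _ * _]mulrC; congr (_ + _ * d _ _);
    exact/val_inj.
have SE (c : 'cV[R]_N.+1) k : (S^T *m c) k 0 =
    \sum_i c i 0 * (if k == 0 then sin (omega * x_ i) else cos (omega * x_ i)).
  by rewrite mxE; apply: eq_bigr => i _; rewrite !mxE mulrC.
have uM : M \in unitmx.
  rewrite -unitmx_tr -row_free_unit; apply: inj_row_free => v vM.
  have : M *m v^T = 0 by rewrite -[RHS]trmx0 -vM trmx_mul trmxK.
  rewrite -[v^T]vsubmxK mul_block_col => /eqP; rewrite col_mx_eq0 => /andP[/eqP h1 /eqP h2].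
  have [|||c0 a0 b0] := @homogeneous_trivial (fun i => usubmx v^T i 0) (dsubmx v^T 0 0)
    (dsubmx v^T 1 0).
  - by have := SE (usubmx v^T) 0; rewrite -[S^T *m _]addr0 -(mul0mx _ (dsubmx v^T)) h2 mxE.
  - by have := SE (usubmx v^T) 1; rewrite -[S^T *m _]addr0 -(mul0mx _ (dsubmx v^T)) h2 mxE.
  - by move=> i; rewrite spline_weight -GE h1 mxE.
  apply: trmx_inj; rewrite trmx0 -[v^T]vsubmxK; apply/eqP; rewrite col_mx_eq0; apply/andP;
    split; apply/eqP/colP => i.
    by rewrite c0 mxE.
  rewrite [RHS]mxE; case: (unliftP 0 i) => [j|] ->; last exact: a0.
  by rewrite ord1; rewrite -[RHS]b0; congr (dsubmx _ _ _); exact/val_inj.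
pose w := invmx M *m col_mx (\col_i G2 omega (z - x_ i))
   (\col_(k < 2) if k == 0 then sin (omega * z) else cos (omega * z)).
have : M *m w = col_mx (\col_i G2 omega (z - x_ i))
   (\col_(k < 2) if k == 0 then sin (omega * z) else cos (omega * z)) by rewrite mulKVmx.
rewrite -[w]vsubmxK mul_block_col => /eq_col_mx[h1 h2].
exists (fun i => usubmx w i 0), (- dsubmx w 0 0), (- dsubmx w 1 0); split.
- have := SE (usubmx w) 0; rewrite -[S^T *m _]addr0 -(mul0mx _ (dsubmx w)) h2 mxE/=.
  by rewrite /error_functional => ->; rewrite subrr.
- have := SE (usubmx w) 1; rewrite -[S^T *m _]addr0 -(mul0mx _ (dsubmx w)) h2 mxE/=.
  by rewrite /error_functional => ->; rewrite subrr.
move=> i; rewrite spline_error.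
have := GE (usubmx w) (dsubmx w) i; rewrite h1 mxE => ->; ring.
Qed.
End Exists.

(** * The characteristic root *)

Section Constants.
Context {R : realType} (omega : R) (N : nat).
Local Notation h := (step R N).
Local Notation th := (omega * h).
Local Notation lam := (lambda omega N).
Local Notation C := (C_cst omega N).
Local Notation A := (A_cst omega N).
Local Notation Q := (lambda_den omega N).
Hypothesis hden : sin th - th * cos th != 0.
Hypothesis hlam : `|lam| < 1.

Lemma sin2x (x : R) : sin (2 * x) = 2 * sin x * cos x.
Proof. by rewrite mulr_natl mulr2n sinD; ring. Qed.

Lemma cos2x (x : R) : cos (2 * x) = 2 * cos x ^+ 2 - 1.
Proof. by rewrite mulr_natl mulr2n cosD -!expr2 sin2cos2; ring. Qed.

Lemma norm_sin_le (x : R) : `|sin x| <= `|x|.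
Proof.
wlog x0 : x / 0 <= x.
  move=> W; case: (leP 0 x) => [|x0]; first exact: W.
  by rewrite -normrN -sinN -[leRHS]normrN; apply: W; rewrite oppr_ge0 ltW.
have [y _] := @MVT_segment R sin cos 0 x x0 (fun y _ => is_derive_sin y)
  (continuous_subspaceT (@continuous_sin R)).
rewrite sin0 !subr0 => ->; rewrite normrM ler_piMl//.
by rewrite ler_norml cos_geN1 cos_le1.
Qed.

Let s1 := sin th - th * cos th.

Lemma C_cstE : C = (2 * th * cos (2 * th) - sin (2 * th)) / s1.
Proof.
have E : 2 * h * omega = 2 * th by ring.
by rewrite /C_cst E (mulrC h omega).
Qed.

Lemma C_cst_trace : C + 4 * cos th = (sin (2 * th) - 2 * th) / s1.
Proof. by rewrite C_cstE sin2x cos2x /s1; field. Qed.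

Lemma lambdaE :
  lam = (sin (2 * th) - 2 * th + 2 * sin th * Num.sqrt (th ^+ 2 - sin th ^+ 2)) / (2 * s1).
Proof.
have E : 2 * h * omega = 2 * th by ring.
rewrite /lambda E (mulrC h omega) /s1; field.
by rewrite hden -opprB oppr_eq0 hden.
Qed.

Lemma sqrt_disc : Num.sqrt (th ^+ 2 - sin th ^+ 2) ^+ 2 = th ^+ 2 - sin th ^+ 2.
Proof.
by rewrite sqr_sqrtr// subr_ge0 -real_normK ?num_real// -[leRHS]real_normK ?num_real//
  lerXn2r ?nnegrE// norm_sin_le.
Qed.

(** The roots of this equation are lambda and its inverse; the square root in lambda comes
    from the discriminant. *)
Lemma lambda_quadratic : lam ^+ 2 - (C + 4 * cos th) * lam + 1 = 0.
Proof.
rewrite C_cst_trace lambdaE sin2x; set r := Num.sqrt _.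
have rr : r ^+ 2 = th ^+ 2 - sin th ^+ 2 := sqrt_disc.
have cc : cos th ^+ 2 = 1 - sin th ^+ 2 by rewrite cos2sin2.
transitivity (((sin th * r) ^+ 2 - (sin th * cos th - th) ^+ 2 + s1 ^+ 2) / s1 ^+ 2).
  by field.
rewrite exprMn rr (_ : _ - _ + _ = 0) ?mul0r// /s1.
by rewrite -[LHS]addr0 !sqrrB !exprMn cc; ring.
Qed.

Lemma lambda_denE : Q = - (2 * th * sin th ^+ 2 / s1) * lam.
Proof.
have E : lam ^+ 2 + 1 = (C + 4 * cos th) * lam.
  by apply/eqP; rewrite -subr_eq0 -[X in _ == X]lambda_quadratic; apply/eqP; ring.
rewrite /lambda_den addrAC E C_cst_trace sin2x sin2cos2 /s1; by field.
Qed.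

(** Both sides are the square of 2 theta sin^2(theta) lambda / s1; this is where the constant A
    meets the three-term operator, through its characteristic polynomial at lambda. *)
Lemma A_cst_lambda_den : lam ^+ 2 - 1 != 0 -> A * (lam ^+ 2 - 1) = Q ^+ 2.
Proof.
move=> l1; rewrite lambda_denE /A_cst (_ : 2 * h * omega = 2 * th); last by ring.
rewrite (mulrC h omega) /s1; field.
by rewrite hden.
Qed.

(** If the sine vanished, the two characteristic roots would coincide, and lambda would be
    1 or -1. *)
Lemma sin_th_neq0 : lam != 0 -> sin th != 0.
Proof.
move=> l0; apply/eqP => s0.
have := lambda_quadratic; rewrite C_cst_trace sin2x s0 /s1 s0 => E.
have c2 : cos th ^+ 2 = 1 by rewrite cos2sin2 s0 expr0n subr0.
have [th0|th0] := eqVneq th 0.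
  by move: hden; rewrite s0 th0 mul0r subr0 eqxx.
have c0 : cos th != 0 by rewrite -sqrf_eq0 c2 oner_eq0.
have : (lam - cos th) ^+ 2 = 0.
  have F : (2 * 0 * cos th - 2 * th) / (0 - th * cos th) = 2 * cos th.
    transitivity (2 * cos th ^+ 2 / cos th); last by field.
    by move: th0; rewrite c2 mulf_eq0 negb_or => /andP[? ?]; field; do ?[apply/andP; split].
  by rewrite -E sqrrB c2 F; ring.
move=> /eqP; rewrite sqrf_eq0 subr_eq0 => /eqP le.
have : `|lam| ^+ 2 < 1 by rewrite expr_lt1.
by rewrite real_normK ?num_real// le c2 ltxx.
Qed.
End Constants.

(** * Geometric tail sums *)

Section Tails.
Context {R : realType}.
Variable lam : R.
Hypothesis hlam : `|lam| < 1.

(** Linear growth is what samples of G2 have; it is dominated by any geometric decay. *)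
Definition lin_growth (f : nat -> R) := exists B, forall k, `|f k| <= B * (k.+1)%:R.

(** With r the square root of `|lam|`, n r^n is at most the sum of the geometric series of
    ratio r, so a factor r^n remains. *)
Lemma cvg_lin_geometric : (n.+1%:R * `|lam| ^+ n) @[n --> \oo] --> (0 : R).
Proof.
pose r := Num.sqrt `|lam|.
have r0 : 0 <= r by exact: sqrtr_ge0.
have rr : r ^+ 2 = `|lam| by rewrite sqr_sqrtr.
have r1 : r < 1 by rewrite -(expr_lt1 (n := 2))// rr.
have bound n : n.+1%:R * r ^+ n <= (1 - r)^-1.
  rewrite -[leRHS]mul1r ler_pdivlMr ?subr_gt0//.
  apply: (@le_trans _ _ ((\sum_(k < n.+1) r ^+ k) * (1 - r))).
    rewrite ler_wpM2r ?subr_ge0 ?(ltW r1)// mulr_natl -[n.+1 in leLHS]card_ord -sumr_const.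
    by apply: ler_sum => i _; rewrite ler_wiXn2l ?(ltW r1)// -ltnS.
  by rewrite mulrC -opprB mulNr -subrX1 opprB gerBl exprn_ge0.
apply: (@squeeze_cvgr _ _ _ _ (fun=> 0) (fun n => (1 - r)^-1 * r ^+ n)).
- near=> n; rewrite mulr_ge0 ?exprn_ge0//=.
  have -> : n.+1%:R * `|lam| ^+ n = n.+1%:R * r ^+ n * r ^+ n.
    by rewrite -rr -exprM mulnC exprM expr2 mulrA.
  by rewrite ler_wpM2r ?exprn_ge0.
- exact: cvg_cst.
- rewrite -[X in _ --> X](mulr0 (1 - r)^-1); apply: cvgM; first exact: cvg_cst.
  by apply: cvg_expr; rewrite ger0_norm.
Unshelve. all: by end_near. Qed.

(** The sum starts at index 1: the term of index 0 belongs to the grid. *)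
Definition tail_sum (e : nat -> R) (L : R) :=
  series (fun k => lam ^+ k.+1 * e k.+1) @ \oo --> L.

(** The form e k = f k - lam f (k+1) turns the partial sums into lam f 1 - lam^(n+1) f (n+1). *)
Lemma tail_telescope (e f : nat -> R) :
  (forall k, (0 < k)%N -> e k = f k - lam * f k.+1) -> lin_growth f ->
  tail_sum e (lam * f 1%N).
Proof.
move=> ef [B hB]; rewrite /tail_sum.
have -> : series (fun k => lam ^+ k.+1 * e k.+1) =
    fun n => lam * f 1%N - lam ^+ n.+1 * f n.+1.
  apply/funext => n; rewrite seriesEnat/=; elim: n => [|n IH].
    by rewrite big_geq// expr1 subrr.
  by rewrite big_nat_recr//= IH ef// [lam ^+ n.+2]exprS; ring.
rewrite -[X in _ --> X]subr0; apply: cvgB; first exact: cvg_cst.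
apply/cvgr0Pnorm_le => eps e0.
have B0 : 0 <= B by have := le_trans (normr_ge0 _) (hB 0%N); rewrite mulr1.
have e1 : 0 < eps / (B + 1) by rewrite divr_gt0// ltr_wpDl.
have := cvg_lin_geometric.
rewrite -(@cvg_shiftS _ (fun n => n.+1%:R * `|lam| ^+ n)) => /cvgr0Pnorm_le /(_ _ e1).
apply: filterS => n; rewrite /= ger0_norm ?mulr_ge0 ?exprn_ge0// => hn.
rewrite normrM normrX mulrC (le_trans (ler_wpM2r _ (hB _))) ?exprn_ge0//.
rewrite -mulrA (le_trans (ler_wpM2l B0 hn))// mulrA ler_pdivrMr ?ltr_wpDl// mulrC.
by rewrite ler_wpM2l ?(ltW e0)// lerDl.
Qed.

Lemma tail_sumD e1 e2 L L' : tail_sum e1 L -> tail_sum e2 L' ->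
  tail_sum (fun k => e1 k + e2 k) (L + L').
Proof.
move=> h1 h2; rewrite /tail_sum.
have -> : series (fun k => lam ^+ k.+1 * (e1 k.+1 + e2 k.+1)) =
   fun n => series (fun k => lam ^+ k.+1 * e1 k.+1) n +
     series (fun k => lam ^+ k.+1 * e2 k.+1) n.
  apply/funext => n; rewrite !seriesEnat/= -big_split/=.
  by apply: eq_bigr => i _; rewrite mulrDr.
exact: cvgD.
Qed.

Lemma tail_sumZ a e L : tail_sum e L -> tail_sum (fun k => a * e k) (a * L).
Proof.
move=> h1; rewrite /tail_sum.
have -> : series (fun k => lam ^+ k.+1 * (a * e k.+1)) =
   fun n => a * series (fun k => lam ^+ k.+1 * e k.+1) n.
  apply/funext => n; rewrite !seriesEnat/= mulr_sumr.
  by apply: eq_bigr => i _; rewrite mulrCA.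
by apply: cvgM => //; exact: cvg_cst.
Qed.

Lemma tail_sum_unique e L L' : tail_sum e L -> tail_sum e L' -> L = L'.
Proof. by move=> h h'; apply: (cvg_unique _ h h'); exact: Rhausdorff. Qed.

Lemma eq_tail_sum e e' L : (forall k, (0 < k)%N -> e k = e' k) -> tail_sum e L -> tail_sum e' L.
Proof.
move=> ee; rewrite /tail_sum.
suff -> : (fun k => lam ^+ k.+1 * e' k.+1) = (fun k => lam ^+ k.+1 * e k.+1) by [].
by apply/funext => k; rewrite ee.
Qed.

Lemma eq_tail_sum_value e e' L L' : (forall k, (0 < k)%N -> e k = e' k) -> L = L' ->
  tail_sum e L -> tail_sum e' L'.
Proof. by move=> ee <-; exact: eq_tail_sum. Qed.

Lemma lin_growthD f g : lin_growth f -> lin_growth g -> lin_growth (fun k => f k + g k).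
Proof.
move=> [B hB] [B' hB']; exists (B + B') => k.
by rewrite mulrDl (le_trans (ler_normD _ _))// lerD.
Qed.

Lemma lin_growthZ a f : lin_growth f -> lin_growth (fun k => a * f k).
Proof.
move=> [B hB]; exists (`|a| * B) => k.
by rewrite normrM -mulrA ler_wpM2l.
Qed.

Lemma lin_growth_bounded f B : (forall k, `|f k| <= B) -> lin_growth f.
Proof.
move=> hB; exists B => k; rewrite (le_trans (hB k))// ler_peMr ?ler1n//.
exact: le_trans (normr_ge0 _) (hB 0%N).
Qed.

Lemma lin_growthM f B : (forall k, `|f k| <= B) -> lin_growth (fun k => k%:R * f k).
Proof.
move=> hB; exists B => k; rewrite normrM mulrC ler_pM// normr_nat ler_nat; exact: leqnSn.
Qed.

Lemma norm_cos_le1 (x : R) : `|cos x| <= 1.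
Proof. by rewrite ler_norml cos_geN1 cos_le1. Qed.
Lemma norm_sin_le1 (x : R) : `|sin x| <= 1.
Proof. by rewrite ler_norml sin_geN1 sin_le1. Qed.

Section closed.
Variable th : R.
Let Q := lam ^+ 2 - 2 * lam * cos th + 1.
Hypothesis Q0 : Q != 0.

Let g al k := (cos (k%:R * th + al) - lam * cos (k%:R * th + al - th)) / Q.

Lemma cosD_addB (x : R) : cos (x + th) + cos (x - th) = 2 * cos x * cos th.
Proof. by rewrite cosB cosD; ring. Qed.

Let cosSS al k : cos (k.+2%:R * th + al) =
  2 * cos th * cos (k.+1%:R * th + al) - cos (k%:R * th + al).
Proof.
apply/eqP; rewrite -subr_eq0 opprB addrA subr_eq0; apply/eqP.
rewrite -[RHS]mulrAC -cosD_addB -!natr1.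
by congr (cos _ + cos _); ring.
Qed.

Let gE al k : g al k - lam * g al k.+1 = cos (k%:R * th + al).
Proof.
have := cosD_addB (k%:R * th + al); set x := k%:R * th + al => E.
have -> : g al k.+1 = (cos (x + th) - lam * cos x) / Q.
  by rewrite /g -natr1 /x; congr ((cos _ - _ * cos _) / _); ring.
have -> : cos (x + th) = 2 * cos x * cos th - cos (x - th) by rewrite -E addrK.
by rewrite /g -/x /Q; field.
Qed.

Let g_le al k : `|g al k| <= (1 + `|lam|) / `|Q|.
Proof.
rewrite /g normrM normfV ler_wpM2r ?invr_ge0// (le_trans (ler_normB _ _))//.
rewrite lerD ?norm_cos_le1// normrM ler_piMr ?norm_cos_le1//.
Qed.

Lemma tail_cos al : tail_sum (fun k => cos (k%:R * th + al))
  (lam * (cos (th + al) - lam * cos al) / Q).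
Proof.
have := @tail_telescope (fun k => cos (k%:R * th + al)) (g al) (fun k _ => esym (gE al k))
  (lin_growth_bounded (g_le al)).
by rewrite /g mul1r addrAC subrr add0r mulrA.
Qed.

Lemma tail_sin al : tail_sum (fun k => sin (k%:R * th + al))
  (lam * (sin (th + al) - lam * sin al) / Q).
Proof.
have := @tail_cos (al - pi / 2).
rewrite addrA !cosBpihalf; apply: eq_tail_sum => k _.
by rewrite addrA cosBpihalf.
Qed.

(** Summation by parts: the telescoping primitive is k times the one of the cosine plus a
    multiple of the increment of the latter. *)
Lemma tail_kcos al : tail_sum (fun k => k%:R * cos (k%:R * th + al))
  (lam * (lam ^+ 2 * cos (th - al) - 2 * lam * cos al + cos (th + al)) / Q ^+ 2).
Proof.
pose f k := k%:R * g al k + lam / Q * (g al k.+1 - lam * g al k).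
have fE k : (0 < k)%N -> k%:R * cos (k%:R * th + al) = f k - lam * f k.+1.
  move=> _; rewrite /f -(gE al) -natr1.
  have H : g al k.+2 = (2 * cos th) * g al k.+1 - g al k.
    by rewrite /g -!addrA !cosSS; field.
  by rewrite H /Q; field.
have gf : lin_growth f.
  apply: lin_growthD; first by apply: lin_growthM => k; exact: g_le.
  apply: lin_growthZ; apply: lin_growthD.
    by apply: lin_growth_bounded => k; exact: g_le.
  apply: (lin_growth_bounded (B := `|lam| * ((1 + `|lam|) / `|Q|))) => k.
  by rewrite normrN normrM ler_wpM2l.
have := tail_telescope fE gf; rewrite /f.
have -> : g al 1 = (cos (th + al) - lam * cos al) / Q.
  by rewrite /g mul1r addrAC subrr add0r.
have -> : g al 2 = (2 * cos (th + al) * cos th - cos al - lam * cos (th + al)) / Q.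
  rewrite /g (cosSS al 0) mul1r mul0r add0r (_ : 2 * th + al - th = th + al); last by ring.
  by rewrite (mulrAC 2).
have -> : cos (th - al) = 2 * cos th * cos al - cos (th + al).
  by rewrite cosB cosD; ring.
by congr (tail_sum _ _); rewrite /Q; field.
Qed.
End closed.
End Tails.

(** * From the interpolation system to the closed formula *)

Section Formula.
Context {R : realType} (omega z : R) (N : nat).
Local Notation h := (step R N).
Local Notation th := (omega * h).
Local Notation lam := (lambda omega N).
Local Notation C := (C_cst omega N).
Local Notation A := (A_cst omega N).
Local Notation Q := (lambda_den omega N).
Local Notation p := (p_cst omega N).
Local Notation x_ i := (step R N * (i : nat)%:R).
Hypotheses (w0 : omega != 0) (Npos : (1 <= N)%N).
Hypothesis hlam : `|lam| < 1.
Hypothesis hcos : cos omega != 0.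
Hypothesis hden : sin th - omega * h * cos th != 0.
Hypothesis hlam0 : lam != 0.
Hypothesis hlam1 : lam ^+ 2 - 1 != 0.
Hypothesis hQ : lam ^+ 2 - 2 * lam * cos th + 1 != 0.
Variables (c : 'I_N.+1 -> R) (a b : R).
Hypothesis ci : spline_system omega z c a b.

Let h0 : 0 < h := step_gt0 Npos.
Let hNE : h * N%:R = 1.
Proof. by rewrite /step mulVf// pnatr_eq0 -lt0n. Qed.

(** By [spline_system] this function interpolates G2 (z - x) at the nodes; unlike G2 (z - x)
    it is, on the whole line, a convolution of the weights with G2 up to sine and cosine. *)
Definition data_ext (x : R) := \sum_j c j * G2 omega (x - x_ j)
  - a * sin (omega * x) - b * cos (omega * x).

Lemma data_ext_node (i : 'I_N.+1) : data_ext (x_ i) = G2 omega (z - x_ i).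
Proof.
have [_ _ /(_ i)] := ci; rewrite spline_error /data_ext => /eqP.
by rewrite addr_eq0 => /eqP E; apply/eqP; rewrite -subr_eq0; apply/eqP; lra.
Qed.

Lemma sum_sin : \sum_j c j * sin (omega * x_ j) = sin (omega * z).
Proof. by have [/eqP] := ci; rewrite /error_functional subr_eq0 => /eqP<-. Qed.

Lemma sum_cos : \sum_j c j * cos (omega * x_ j) = cos (omega * z).
Proof. by have [_ /eqP] := ci; rewrite /error_functional subr_eq0 => /eqP<-. Qed.

Lemma G2_ge0 (x : R) : 0 <= x ->
  G2 omega x = (sin (omega * x) - omega * x * cos (omega * x)) / (4 * omega ^+ 3).
Proof.
rewrite le_eqVlt => /predU1P[<-|x0]; rewrite /G2; last by rewrite gtr0_sg//; ring.
by rewrite sgr0 !mulr0 sin0 mul0r subr0 !mul0r.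
Qed.

Let P1 := \sum_j c j * (x_ j * cos (omega * x_ j)).
Let P2 := \sum_j c j * (x_ j * sin (omega * x_ j)).
(** These four numbers turn out to be d1_minus, d1_plus, d2_minus and d2_plus, once the linear
    system for dm and dp is available. *)
Let dm := - (cos (omega * z) + omega * P2) / (4 * omega ^+ 3) - a.
Let dp := (cos (omega * z) + omega * P2) / (4 * omega ^+ 3) - a.
Let d2m := (sin (omega * z) - omega * P1) / (4 * omega ^+ 3) - b.
Let d2p := - (sin (omega * z) - omega * P1) / (4 * omega ^+ 3) - b.

(** Left of the grid all arguments of G2 have the same sign, so the sum collapses by the
    addition formulas and the constraints; the weights enter through dm and d2m
    only. *)
Lemma data_ext_left (X : R) : 0 <= X -> data_ext (- X) =
  - dm * sin (omega * X) + d2m * cos (omega * X) - X / (4 * omega ^+ 2) * cos (omega * (X + z)).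
Proof.
move=> X0; rewrite /data_ext.
pose S := sin (omega * X); pose Co := cos (omega * X); pose k := (4 * omega ^+ 3)^-1.
rewrite (eq_bigr (fun j => ((k * Co + k * omega * X * S) * (c j * sin (omega * x_ j)) +
   (k * S - k * omega * X * Co) * (c j * cos (omega * x_ j))) +
   ((- k * omega * Co) * (c j * (x_ j * cos (omega * x_ j))) +
   (k * omega * S) * (c j * (x_ j * sin (omega * x_ j)))))); last first.
  move=> j _; rewrite -opprD G2N G2_ge0 ?addr_ge0 ?mulr_ge0 ?ler0n ?(ltW h0)//.
  by rewrite mulrDr sinD cosD -/S -/Co -/k; ring.
rewrite !big_split/= -!mulr_sumr sum_sin sum_cos -/P1 -/P2 mulrN sinN cosN mulrDr cosD.
by rewrite -/S -/Co /dm /d2m /k; field.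
Qed.

Lemma data_ext_right (X : R) : 1 <= X -> data_ext X =
  dp * sin (omega * X) + d2p * cos (omega * X) - X / (4 * omega ^+ 2) * cos (omega * (X - z)).
Proof.
move=> X1; rewrite /data_ext.
pose S := sin (omega * X); pose Co := cos (omega * X); pose k := (4 * omega ^+ 3)^-1.
rewrite (eq_bigr (fun j => ((- k * Co - k * omega * X * S) * (c j * sin (omega * x_ j)) +
   (k * S - k * omega * X * Co) * (c j * cos (omega * x_ j))) +
   ((k * omega * Co) * (c j * (x_ j * cos (omega * x_ j))) +
   (k * omega * S) * (c j * (x_ j * sin (omega * x_ j)))))); last first.
  move=> j _; rewrite G2_ge0; last first.
    have /andP[_ xj] := @node01 R _ Npos j.
    by rewrite subr_ge0 (le_trans xj).
  by rewrite mulrBr sinB cosB -/S -/Co -/k; ring.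
rewrite !big_split/= -!mulr_sumr sum_sin sum_cos -/P1 -/P2 mulrBr cosB.
by rewrite -/S -/Co /dp /d2p /k; field.
Qed.

Lemma d2m_E : d2m = G2 omega z.
Proof.
have := data_ext_node ord0; rewrite mulr0 subr0 => <-.
by rewrite -{1}oppr0 data_ext_left// mulr0 sin0 cos0; ring.
Qed.

Lemma d2p_E : d2p = (cos omega)^-1 * (G2 omega (z - 1) +
  cos (omega * (1 - z)) / (4 * omega ^+ 2) - dp * sin omega).
Proof.
have := data_ext_node ord_max; rewrite /= hNE => <-.
by rewrite data_ext_right// mulr1; field; rewrite hcos w0.
Qed.

Lemma G2_growth (x : R) :
  `|G2 omega x| <= `|(4 * omega ^+ 3)^-1| * (1 + `|omega|) * (1 + `|x|).
Proof.
have -> : G2 omega x = (4 * omega ^+ 3)^-1 *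
    (Num.sg x * (sin (omega * x) - omega * x * cos (omega * x))) by rewrite /G2; ring.
rewrite normrM -[leRHS]mulrA ler_wpM2l// normrM -[leRHS]mul1r ler_pM//.
  by rewrite normr_sg; case: (x != 0).
rewrite (le_trans (ler_normB _ _))// mulrDr mulr1 mulrDl mul1r -addrA lerD ?norm_sin_le1//.
rewrite normrM normrM ler_wpDl// ler_wpDl// ler_piMr ?norm_cos_le1//.
Qed.

Lemma data_ext_growth : exists B, forall x, `|data_ext x| <= B * (1 + `|x|).
Proof.
have growD (f g : R -> R) : (exists B, forall x : R, `|f x| <= B * (1 + `|x|)) ->
    (exists B, forall x : R, `|g x| <= B * (1 + `|x|)) ->
    exists B, forall x : R, `|f x + g x : R| <= B * (1 + `|x|).
  move=> [B1 h1] [B2 h2]; exists (B1 + B2) => x.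
  by rewrite mulrDl (le_trans (ler_normD _ _))// lerD.
have bnd e (f : R -> R) : (forall x, `|f x| <= 1) ->
    exists B, forall x : R, `|- (e * f x)| <= B * (1 + `|x|).
  move=> hf; exists `|e| => x; rewrite normrN normrM ler_wpM2l//.
  by rewrite (le_trans (hf x))// lerDl.
apply: (growD); last by apply: (bnd b (fun x => cos (omega * x))) => x; exact: norm_cos_le1.
apply: (growD); last by apply: (bnd a (fun x => sin (omega * x))) => x; exact: norm_sin_le1.
pose k := `|(4 * omega ^+ 3)^-1| * (1 + `|omega|).
have k0 : 0 <= k by rewrite mulr_ge0// addr_ge0.
exists (\sum_j `|c j| * k * 2) => x.
rewrite mulr_suml (le_trans (ler_norm_sum _ _ _))//; apply: ler_sum => j _.
rewrite normrM (_ : `|c j| * k * 2 * (1 + `|x|) = `|c j| * (k * (2 * (1 + `|x|))));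
  last by ring.
rewrite ler_wpM2l// (le_trans (G2_growth _))// -/k ler_wpM2l//.
have := ler_normB x (x_ j); have /andP[x0 x1] := @node01 R _ Npos j.
rewrite (ger0_norm x0); have := normr_ge0 x; lra.
Qed.

Definition data (j : int) := data_ext (h * j%:~R).
(** The weights, extended by 0 outside the grid. *)
Definition coef (j : int) : R := \sum_g c g * (j == (g : nat)%:Z)%:R.

Let il := lam^-1.
Let trace := lam + il.
Let pinv := (sin th - th * cos th) / (2 * omega ^+ 3).

Lemma p_pinv : p * pinv = 1.
Proof. by rewrite /p_cst /pinv; field; rewrite w0 hden. Qed.

(** Relates C to the sum of the two characteristic roots. *)
Lemma C_trace : C = trace - 4 * cos th.
Proof.
have E := lambda_quadratic hden.
have -> : trace = (lam ^+ 2 + 1) / lam by rewrite /trace /il; field.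
have -> : lam ^+ 2 + 1 = (C + 4 * cos th) * lam.
  by apply/eqP; rewrite -subr_eq0 -[X in _ == X]E; apply/eqP; ring.
by field.
Qed.

(** One of the two smooth branches of the samples of G2; it is odd, while G2 is even. *)
Let sb (x : R) := (sin (th * x) - th * x * cos (th * x)) / (4 * omega ^+ 3).

(** Samples of sine, cosine and index times cosine are killed by the square of E - 2 cos
    theta + E^-1, written out here, where E is the shift. *)
Lemma sb_rec (x : R) :
  sb (x + 1 + 1) + sb (x - 1 - 1) - 4 * cos th * (sb (x + 1) + sb (x - 1))
  + (2 + 4 * cos th ^+ 2) * sb x = 0.
Proof.
rewrite /sb !mulrDr !mulrN mulr1.
pose S := sin (th * x); pose Co := cos (th * x); pose s := sin th; pose k := cos th.
rewrite !(sinD, cosD, sinN, cosN) -/S -/Co -/s -/k.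
have ss : s * s = 1 - k * k by rewrite -!expr2 /s /k sin2cos2.
by field: ss.
Qed.

Let W (x : R) := G2 omega (h * x).

Let WN x : W (- x) = W x.
Proof. by rewrite /W mulrN G2N. Qed.

Let W_sb x : 0 <= x -> W x = sb x.
Proof. by move=> x0; rewrite /W G2_ge0 ?mulr_ge0 ?(ltW h0)// /sb !mulrA. Qed.

Let sbN x : sb (- x) = - sb x.
Proof. by rewrite /sb !mulrN sinN cosN; ring. Qed.

Let sb0 : sb 0 = 0.
Proof. by rewrite /sb !mulr0 sin0 mul0r subr0 mul0r. Qed.

Let sb1 : sb 1 = pinv / 2.
Proof. by rewrite /sb /pinv !mulr1; field. Qed.

Let sb2 : sb (1 + 1) = - C * (pinv / 2).
Proof.
rewrite C_cstE /sb /pinv (_ : th * (1 + 1) = 2 * th); last by ring.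
by field; rewrite w0 hden.
Qed.

Let W_rec_nat (n : nat) :
  W (n%:R + 1 + 1) + W (n%:R - 1 - 1) - 4 * cos th * (W (n%:R + 1) + W (n%:R - 1))
  + (2 + 4 * cos th ^+ 2) * W n%:R = pinv * ((n == 1%N)%:R - trace * (n == 0%N)%:R).
Proof.
have W1 : W 1 = sb 1 by rewrite W_sb.
have W2 : W (1 + 1) = sb (1 + 1) by rewrite W_sb// addr_ge0.
have mE : trace = C + 4 * cos th by rewrite C_trace; ring.
case: n => [|[|n]].
- rewrite !add0r -opprD !WN W1 W2 (W_sb (lexx _)) sb0 sb1 sb2 eqxx /= mE; by field.
- rewrite subrr add0r WN W1 (W_sb (lexx _)) W2 eqxx /=.
  have := sb_rec 1; rewrite subrr add0r sbN sb0 (W_sb (_ : 0 <= 1 + 1 + 1)) ?addr_ge0// => E.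
  apply/eqP; rewrite -subr_eq0 -[X in _ == X]E sb1; apply/eqP; by field.
rewrite [RHS](_ : _ = 0); last by rewrite /= mulr0 subr0 mulr0.
have n0 : 0 <= n%:R :> R by exact: ler0n.
have -> : n.+2%:R = n%:R + 1 + 1 :> R by rewrite !natr1.
rewrite !addrK !W_sb ?addr_ge0//.
by have := sb_rec (n%:R + 1 + 1); rewrite !addrK.
Qed.

(** The sign in G2 breaks the recurrence only at the indices -1, 0 and 1. The defect there is
    proportional to the polynomial with roots lambda and 1 / lambda. *)
Lemma W_rec (j : int) :
  W (j + 1 + 1)%:~R + W (j - 1 - 1)%:~R - 4 * cos th * (W (j + 1)%:~R + W (j - 1)%:~R)
  + (2 + 4 * cos th ^+ 2) * W j%:~R =
  pinv * ((j + 1 == 0)%:R + (j - 1 == 0)%:R - trace * (j == 0)%:R).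
Proof.
wlog j0 : j / (0 <= j) => [H|].
  case: (leP 0 j) => [|jn]; first exact: H.
  have := H (- j); rewrite oppr_ge0 (ltW jn) => /(_ isT).
  have -> : - j + 1 + 1 = - (j - 1 - 1) by ring.
  have -> : - j - 1 - 1 = - (j + 1 + 1) by ring.
  have -> : - j + 1 = - (j - 1) by ring.
  have -> : - j - 1 = - (j + 1) by ring.
  rewrite !oppr_eq0 !intrN !WN => E.
  by rewrite [(j + 1 == 0)%:R + _]addrC -E; ring.
case: j j0 => // n _.
have := W_rec_nat n; rewrite !(intrD, intrB) -!pmulrn => ->.
congr (_ * (_ - _)).
have -> : (Posz n + 1 == 0) = false by clear; lia.
have -> : (Posz n - 1 == 0) = (n == 1%N) by apply/eqP/eqP; clear; lia.
by rewrite add0r.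
Qed.

Let data_conv j :
  data j = \sum_g c g * W (j - (g : nat)%:Z)%:~R - a * sin (th * j%:~R) - b * cos (th * j%:~R).
Proof.
rewrite /data /data_ext !mulrA; congr (_ - _ - _); apply: eq_bigr => g _.
by rewrite /W intrB -pmulrn mulrBr.
Qed.

Let trig_rec (e1 e2 x : R) (f := fun x => e1 * sin (th * x) + e2 * cos (th * x)) :
  f (x + 1 + 1) + f (x - 1 - 1) - 4 * cos th * (f (x + 1) + f (x - 1))
  + (2 + 4 * cos th ^+ 2) * f x = 0.
Proof.
rewrite /f !mulrDr !mulrN mulr1.
pose S := sin (th * x); pose Co := cos (th * x); pose s := sin th; pose k := cos th.
rewrite !(sinD, cosD, sinN, cosN) -/S -/Co -/s -/k.
have ss : s * s = 1 - k * k by rewrite -!expr2 /s /k sin2cos2.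
by ring: ss.
Qed.

Let coef_shift j (d : int) : coef (j + d) = \sum_g c g * (j - (g : nat)%:Z + d == 0)%:R.
Proof.
apply: eq_bigr => g _; congr (_ * (nat_of_bool _)%:R).
by apply/eqP/eqP; clear; lia.
Qed.

(** The same recurrence after convolution with the weights: the defect becomes a three-term
    expression in the weights. *)
Lemma data_rec j :
  data (j + 1 + 1) + data (j - 1 - 1) - 4 * cos th * (data (j + 1) + data (j - 1))
  + (2 + 4 * cos th ^+ 2) * data j = pinv * (coef (j + 1) + coef (j - 1) - trace * coef j).
Proof.
have -> : coef j = coef (j + 0) by rewrite addr0.
rewrite !coef_shift !data_conv.
have := trig_rec (- a) (- b) j%:~R; rewrite !(intrD, intrB) !mulr1z => E.
pose w (d : int) := \sum_g c g * W (j - (g : nat)%:Z + d)%:~R.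
have wE (k d : int) : k = j + d -> \sum_g c g * W (k - (g : nat)%:Z)%:~R = w d.
  by move=> ->; apply: eq_bigr => g _; rewrite addrAC.
rewrite (wE (j + 1 + 1) 2) ?(wE (j - 1 - 1) (-2)) ?(wE (j +
  1) 1) ?(wE (j - 1) (-1)) ?(wE j 0) ?addr0//; [|clear; lia..].
transitivity (w 2 + w (-2) - 4 * cos th * (w 1 + w (-1)) + (2 + 4 * cos th ^+ 2) * w 0).
  by rewrite -[RHS]addr0 -E; ring.
transitivity (\sum_g c g * (pinv * ((j - (g : nat)%:Z + 1 == 0)%:R +
  (j - (g : nat)%:Z - 1 == 0)%:R
   - trace * (j - (g : nat)%:Z == 0)%:R))).
  symmetry; rewrite (eq_bigr (fun g => c g * W (j - (g : nat)%:Z + 2)%:~R +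
     c g * W (j - (g : nat)%:Z + -2)%:~R +
     - (4 * cos th) * (c g * W (j - (g : nat)%:Z + 1)%:~R) +
     - (4 * cos th) * (c g * W (j - (g : nat)%:Z + -1)%:~R) +
     (2 + 4 * cos th ^+ 2) * (c g * W (j - (g : nat)%:Z + 0)%:~R))).
    by rewrite !big_split/= -!mulr_sumr -/(w 2) -/(w (-2)) -/(w 1) -/(w (-1)) -/(w 0); ring.
  move=> g _; rewrite -W_rec addr0.
  have -> : j - (g : nat)%:Z + 2 = j - (g : nat)%:Z + 1 + 1 by clear; lia.
  have -> : j - (g : nat)%:Z + -2 = j - (g : nat)%:Z - 1 - 1 by clear; lia.
  ring.
rewrite (eq_bigr (fun g => pinv * (c g * (j - (g : nat)%:Z + 1 == 0)%:R) +
     pinv * (c g * (j - (g : nat)%:Z - 1 == 0)%:R) +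
     - (pinv * trace) * (c g * (j - (g : nat)%:Z + 0 == 0)%:R))).
  by rewrite !big_split/= -!mulr_sumr; ring.
by move=> g _; rewrite addr0; ring.
Qed.

Let Q0 : Q != 0. Proof. exact: hQ. Qed.

(** The part of the closed formula that only involves neighbouring data. *)
Definition local_part j := data (j - 1) + C * data j + data (j + 1).
(** This is the geometric sum of data j, lam data (j-1), lam^2 data (j-2), ... in closed form.
    Dividing the recurrence for the data by the root 1 / lam leaves a first-order recurrence,
    [left_sum_rec], of which the expression below is the solution with linear growth. *)
Definition left_sum j :=
  (pinv * (coef (j + 1) - il * coef j) - local_part (j + 1) + il * local_part j)
  * (lam ^+ 2 / Q ^+ 2).

(** The mirror image of [left_sum], summing data j, lam data (j+1), ... *)
Definition right_sum j :=
  (pinv * (coef (j - 1) - il * coef j) - local_part (j - 1) + il * local_part j)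
  * (lam ^+ 2 / Q ^+ 2).

Let local_part_rec j : local_part (j + 1) + local_part (j - 1) - trace * local_part j
  + Q ^+ 2 / lam ^+ 2 * data j =
  pinv * (coef (j + 1) + coef (j - 1) - trace * coef j).
Proof.
rewrite -data_rec /local_part addrK subrK C_trace /trace /il /lambda_den; field.
by [].
Qed.

Lemma left_sum_rec j : left_sum j - lam * left_sum (j - 1) = data j.
Proof.
have E := local_part_rec j.
rewrite /left_sum subrK; set c1 := coef (j + 1) in E *; set c2 := coef (j - 1) in E *.
set y1 := local_part (j + 1) in E *; set y2 := local_part (j - 1) in E *.
transitivity ((pinv * (c1 + c2 - trace * coef j) - y1 - y2 +
  trace * local_part j) * (lam ^+ 2 / Q ^+ 2)).
  by rewrite /trace /il; field; rewrite Q0 hlam0.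
by rewrite -E; field; rewrite Q0 hlam0.
Qed.

Lemma right_sum_rec j : right_sum j - lam * right_sum (j + 1) = data j.
Proof.
have E := local_part_rec j.
rewrite /right_sum addrK; set c1 := coef (j + 1) in E *; set c2 := coef (j - 1) in E *.
set y1 := local_part (j + 1) in E *; set y2 := local_part (j - 1) in E *.
transitivity ((pinv * (c1 + c2 - trace * coef j) - y1 - y2 +
  trace * local_part j) * (lam ^+ 2 / Q ^+ 2)).
  by rewrite /trace /il; field; rewrite Q0 hlam0.
by rewrite -E; field; rewrite Q0 hlam0.
Qed.

(** The inverse of the convolution with G2. Adding the closed forms of the two geometric
    sums eliminates the neighbouring weights. *)
Lemma coef_formula j :
  coef j = p * (local_part j + A / lam * (left_sum j + right_sum j - data j)).
Proof.
have E := local_part_rec j.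
have -> : A = Q ^+ 2 / (lam ^+ 2 - 1) by rewrite -(A_cst_lambda_den hden hlam1); field.
have -> : left_sum j + right_sum j - data j = (pinv * (lam - il) * coef j +
  (il - lam) * local_part j) * (lam ^+ 2 / Q ^+ 2).
  have -> : data j = (pinv * (coef (j + 1) + coef (j - 1) - trace * coef j) - local_part (j
    + 1) - local_part (j - 1) + trace * local_part j)
      * (lam ^+ 2 / Q ^+ 2) by rewrite -E; field; rewrite Q0 hlam0.
  by rewrite /left_sum /right_sum /trace; ring.
transitivity (p * pinv * coef j); first by rewrite p_pinv mul1r.
by rewrite /il; field; rewrite ?Q0 ?hlam0 ?hlam1.
Qed.

Let lingrowth (f : int -> R) := forall j0 e : int, lin_growth (fun k : nat => f (j0 +
  e * k%:Z)).

Let lingD f g : lingrowth f -> lingrowth g -> lingrowth (fun j => f j + g j).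
Proof. by move=> hf hg j0 e; apply: lin_growthD. Qed.

Let lingZ x f : lingrowth f -> lingrowth (fun j => x * f j).
Proof. by move=> hf j0 e; apply: lin_growthZ. Qed.

Let ling_shift d f : lingrowth f -> lingrowth (fun j => f (j + d)).
Proof.
move=> hf j0 e; have [B hB] := hf (j0 + d) e; exists B => k.
by rewrite addrAC.
Qed.

Let ling_c : lingrowth coef.
Proof.
move=> j0 e; apply: (lin_growth_bounded (B := \sum_g `|c g|)) => k.
rewrite (le_trans (ler_norm_sum _ _ _))//; apply: ler_sum => g _.
by rewrite normrM ler_piMr// ger0_norm// lern1 leq_b1.
Qed.

Let ling_v : lingrowth data.
Proof.
move=> j0 e; have [B hB] := data_ext_growth.
have B0 : 0 <= B by have := le_trans (normr_ge0 _) (hB 0); rewrite normr0 addr0 mulr1.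
pose x := `|h * j0%:~R|; pose y := `|h * e%:~R|.
exists (B * (1 + x + y)) => k; rewrite (le_trans (hB _))// -mulrA ler_wpM2l//.
have := ler_normD (h * j0%:~R) (h * e%:~R * k%:R).
rewrite intrD intrM -pmulrn mulrDr mulrA (normrM _ k%:R) normr_nat -/x -/y -natr1.
have := normr_ge0 (h * j0%:~R); have := normr_ge0 (h * e%:~R); rewrite -/x -/y.
have := ler0n R k; nra.
Qed.

Let ling_Y : lingrowth local_part.
Proof.
by apply: lingD; [apply: lingD; [exact: ling_shift|exact: lingZ]|exact: ling_shift].
Qed.

Let ling_N f : lingrowth f -> lingrowth (fun j => - f j).
Proof. by move=> hf j0 e; have [B hB] := hf j0 e; exists B => k; rewrite normrN. Qed.

Let ling_m : lingrowth left_sum.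
Proof.
move=> j0 e.
have : lingrowth (fun j => (lam ^+ 2 / Q ^+ 2) * (pinv * (coef (j + 1) + - (il * coef j)) +
  - local_part (j + 1) + il * local_part j)).
  apply: lingZ; apply: lingD; [apply: lingD|exact: lingZ].
    by apply: lingZ; apply: lingD; [exact: ling_shift|apply/ling_N/lingZ].
  by apply: ling_N; exact: (@ling_shift 1 local_part).
by move=> /(_ j0 e)[B hB]; exists B => k; rewrite /left_sum mulrC.
Qed.

Let ling_n : lingrowth right_sum.
Proof.
move=> j0 e.
have : lingrowth (fun j => (lam ^+ 2 / Q ^+ 2) * (pinv * (coef (j + -1) +
  - (il * coef j)) + - local_part (j + -1) + il * local_part j)).
  apply: lingZ; apply: lingD; [apply: lingD|exact: lingZ].
    by apply: lingZ; apply: lingD; [exact: ling_shift|apply/ling_N/lingZ].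
  by apply: ling_N; exact: (@ling_shift (-1) local_part).
by move=> /(_ j0 e)[B hB]; exists B => k; rewrite /right_sum mulrC.
Qed.

(** Linear growth makes the telescoping sum of [left_sum_rec] converge. *)
Lemma left_tail : tail_sum lam (fun k => data (- k%:Z)) (lam * left_sum (-1)).
Proof.
have g : lin_growth (fun k : nat => left_sum (- k%:Z)).
  have [B hB] := ling_m 0 (-1); exists B => k; have := hB k.
  by rewrite add0r mulN1r.
apply: (tail_telescope hlam (f := fun k => left_sum (- k%:Z)) _ g) => k _.
by rewrite -left_sum_rec; congr (_ - _ * left_sum _); clear; lia.
Qed.

Lemma right_tail : tail_sum lam (fun k => data (N%:Z + k%:Z)) (lam * right_sum (N%:Z + 1)).
Proof.
have g : lin_growth (fun k : nat => right_sum (N%:Z + k%:Z)).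
  have [B hB] := ling_n N 1; exists B => k; have := hB k.
  by rewrite mul1r.
apply: (tail_telescope hlam (f := fun k => right_sum (N%:Z + k%:Z)) _ g) => k _.
by rewrite -right_sum_rec; congr (_ - _ * right_sum _); clear; lia.
Qed.

Lemma data_left (k : nat) : data (- k%:Z) =
  - dm * sin (k%:R * th) + G2 omega z * cos (k%:R * th)
  - h * k%:R / (4 * omega ^+ 2) * cos (k%:R * th + omega * z).
Proof.
rewrite /data intrN mulrN -pmulrn data_ext_left; last by rewrite mulr_ge0 ?(ltW h0)// ler0n.
rewrite d2m_E mulrDr (_ : omega * (h * k%:R) = k%:R * th)//; ring.
Qed.

Lemma data_right (k : nat) : data (N%:Z + k%:Z) =
  dp * sin (k%:R * th + omega) + d2p * cos (k%:R * th + omega)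
  - h / (4 * omega ^+ 2) * ((N + k)%:R * cos (omega * (h * (N + k)%:R - z))).
Proof.
have E : omega * (h * (N + k)%:R) = k%:R * th + omega.
  by rewrite natrD mulrDr hNE; ring.
rewrite /data -PoszD -pmulrn data_ext_right; last by rewrite natrD mulrDr hNE lerDl
  mulr_ge0 ?(ltW h0)// ler0n.
by rewrite -E; ring.
Qed.

(** Two evaluations of the same tail, one by telescoping and one by inserting the explicit
    data left of the grid. *)
Lemma left_value : lam * left_sum (-1) =
  - dm * (lam * sin th / Q) + G2 omega z * K5 omega N - h / (4 * omega ^+ 2) * K2 omega N z.
Proof.
apply: (tail_sum_unique left_tail).
have t1 := tail_sumZ (a := (- dm)) (tail_sin hlam hQ (al := 0)).
have t2 := tail_sumZ (a := (G2 omega z)) (tail_cos hlam hQ (al := 0)).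
have t3 := tail_sumZ (a := (- (h / (4 * omega ^+ 2)))) (tail_kcos hlam hQ (al := omega * z)).
have := tail_sumD (tail_sumD t1 t2) t3.
apply: eq_tail_sum_value => [k _|]; first by rewrite data_left !addr0; ring.
rewrite !addr0 sin0 cos0 mulr0 subr0 mulr1 /K5 /K2.
rewrite (mulrBr omega h z) (mulrDr omega h z).
by rewrite /lambda_den; field; rewrite w0 hQ.
Qed.

(** As on the left; the convergence of the series K3 comes for free, since it is a linear
    combination of the other tails. *)
Lemma right_value : lam * right_sum (N%:Z + 1) =
  dp * K8 omega N + d2p * K1 omega N - h / (4 * omega ^+ 2) * K3 omega N z.
Proof.
have t1 := tail_sumZ (a := dp) (tail_sin hlam hQ (al := omega)).
have t2 := tail_sumZ (a := d2p) (tail_cos hlam hQ (al := omega)).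
have t3 := tail_sumD (tail_sumD t1 t2) (tail_sumZ (a := (-1)) right_tail).
(* Solve the formula for the data right of the grid for the terms of K3. *)
have t4 := tail_sumZ (a := (4 * omega ^+ 2 / h)) t3.
have hn0 : h != 0 by rewrite gt_eqF.
have t5 : tail_sum lam (fun k => (N + k)%:R * cos (omega * (h * (N + k)%:R - z)))
    (K3 omega N z).
  have := t4; set L := (X in tail_sum _ _ X) => {}t4.
  have {}t4 : tail_sum lam (fun k => (N + k)%:R * cos (omega * (h * (N + k)%:R - z))) L.
    by move: t4; apply: eq_tail_sum => k _; rewrite data_right; field; rewrite hn0 w0.
  suff <- : L = K3 omega N z by [].
  apply/esym/cvg_lim; first exact: Rhausdorff.
  move: t4; rewrite /tail_sum.
  suff -> : (fun k => lam ^+ k.+1 * ((N + k.+1)%:R * cos (omega * (h * (N + k.+1)%:R - z)))) =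
    (fun k => lam ^+ k.+1 * (N + k.+1)%:R * cos (omega * (h * (N + k.+1)%:R - z))) by [].
  by apply/funext => k; rewrite mulrA.
apply: (tail_sum_unique right_tail).
have := tail_sumD (tail_sumD t1 t2) (tail_sumZ (a := (- (h / (4 * omega ^+ 2)))) t5).
apply: eq_tail_sum_value => [k _|]; first by rewrite data_right; ring.
rewrite /K8 /K1 (_ : omega * (h + 1) = th + omega); last by ring.
rewrite (_ : omega * (1 + h) = th + omega); last by ring.
by rewrite /lambda_den; ring.
Qed.

Lemma left_sum_nat (k : nat) : left_sum k%:Z - data k%:Z =
  \sum_(0 <= g < k) lam ^+ (k - g) * data g%:Z + lam ^+ k * (lam * left_sum (-1)).
Proof.
elim: k => [|k IH]; first by rewrite big_geq// add0r expr0 mul1r -{1}(left_sum_rec 0); ring.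
rewrite -(left_sum_rec k.+1) (_ : k.+1%:Z - 1 = k); last by clear; lia.
rewrite big_nat_recr//= subSnn expr1.
rewrite (eq_big_nat _ _ (F2 := fun g => lam * (lam ^+ (k - g) * data g%:Z))); last first.
  by move=> g /andP[_ green]; rewrite subSn ?(ltnW green)// exprS mulrA.
rewrite -mulr_sumr exprS; have -> : left_sum k = (left_sum k%:Z - data k%:Z) +
  data k%:Z by rewrite subrK.
by rewrite IH; ring.
Qed.

Lemma right_sum_nat (k : nat) : (k <= N)%N -> right_sum k%:Z =
  \sum_(k <= g < N.+1) lam ^+ (g - k) * data g%:Z +
    lam ^+ (N - k) * (lam * right_sum (N%:Z + 1)).
Proof.
move=> kN; have [d] : exists d, (k + d = N)%N by exists (N - k)%N; rewrite subnKC.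
elim: d k kN => [|d IH] k kN E.
  rewrite addn0 in E; rewrite E big_nat1 subnn expr0 !mul1r -[in RHS](right_sum_rec N); ring.
have kN' : (k < N)%N by rewrite -E -addn1 leq_add2l.
rewrite -[LHS](subrK (lam * right_sum (k%:Z + 1))) right_sum_rec -PoszD addn1 IH// ?addSnnS//.
rewrite [in RHS]big_ltn ?ltnS// subnn expr0 mul1r -[RHS]addrA; congr (_ + _).
rewrite mulrDr mulr_sumr; congr (_ + _); last by rewrite [in LHS]mulrA -exprS -subSn// subSS.
apply: eq_big_nat => g /andP[kg _].
by rewrite mulrA -exprS -subSn// subSS.
Qed.

Let M := lam * left_sum (-1).
Let N' := lam * right_sum (N%:Z + 1).
Let G (x : R) := G2 omega x.

Lemma data_node (g : nat) : (g <= N)%N -> data g%:Z = G (z - h * g%:R).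
Proof.
rewrite -ltnS => gN; rewrite /data -pmulrn.
exact: (data_ext_node (Ordinal gN)).
Qed.

Lemma two_sided_sum_nat (k : nat) : (k <= N)%N ->
  left_sum k%:Z + right_sum k%:Z - data k%:Z =
  \sum_(g < N.+1) lam ^+ `|k%:Z - (g : nat)%:Z|%N * G (z - h * (g : nat)%:R)
  + lam ^+ k * M + lam ^+ (N - k) * N'.
Proof.
move=> kN; rewrite addrAC left_sum_nat right_sum_nat// -/M -/N'.
rewrite -(big_mkord xpredT (fun g => lam ^+ `|k%:Z - g%:Z|%N * G (z - h * g%:R))).
rewrite [in RHS](big_cat_nat (n := k)) ?leqW//=.
rewrite (eq_big_nat _ _ (F2 := fun g => lam ^+ `|k%:Z - g%:Z|%N * G (z - h * g%:R)));
  last first.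
  move=> g /andP[_ green]; rewrite data_node; last by move: green kN; clear; lia.
  by congr (_ ^+ _ * _); move: green; clear; lia.
rewrite [X in _ + (X + _)](eq_big_nat _ _ (F2 :=
  fun g => lam ^+ `|k%:Z - g%:Z|%N * G (z - h * g%:R))); last first.
  move=> g /andP[green gN]; rewrite data_node; last by move: gN; clear; lia.
  by congr (_ ^+ _ * _); move: green; clear; lia.
by ring.
Qed.

Lemma coef_node (g : 'I_N.+1) : coef (g : nat)%:Z = c g.
Proof.
rewrite /coef (bigD1 g)//= eqxx mulr1 big1 ?addr0// => i ig.
by rewrite (_ : _ == _ = false) ?mulr0//; apply/negbTE; rewrite eqz_nat eq_sym.
Qed.

Lemma coef_out (j : int) : (j < 0) || (N%:Z < j) -> coef j = 0.
Proof.
move=> jout; rewrite /coef big1// => i _; rewrite (_ : _ == _ = false) ?mulr0//.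
by apply/negbTE/eqP => ji; have := ltn_ord i; move: jout ji; clear; lia.
Qed.

Let p_neq0 : p != 0.
Proof. by rewrite /p_cst mulf_neq0 ?invr_neq0// mulf_neq0 ?expf_neq0// pnatr_eq0. Qed.

Lemma local_part_out j : (j < 0) || (N%:Z < j) ->
  local_part j + A / lam * (left_sum j + right_sum j - data j) = 0.
Proof.
move=> /coef_out E; apply/eqP; have := coef_formula j; rewrite E => /esym/eqP.
by rewrite mulf_eq0 (negbTE p_neq0).
Qed.

Let g1 := G2 omega (z - 1) + cos (omega * (1 - z)) / (4 * omega ^+ 2).

Lemma data_right_reduced (k : nat) : data (N%:Z + k%:Z) =
  dp * (sin (k%:R * th) / cos omega) + cos (k%:R * th + omega) / cos omega * g1
  - h / (4 * omega ^+ 2) * ((N + k)%:R * cos (omega * (h * (N + k)%:R - z))).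
Proof.
rewrite data_right d2p_E -/g1; congr (_ - _).
have -> : sin (k%:R * th) = sin (k%:R * th + omega) * cos omega - cos (k%:R * th +
  omega) * sin omega.
  by rewrite -sinB addrK.
by field.
Qed.

(** The unknown d2p has been eliminated with its value at the last node, so dp is the only
    unknown left. *)
Lemma right_value_reduced :
  N' = dp * (lam * sin th / (Q * cos omega)) + K1 omega N / cos omega * g1
   - h / (4 * omega ^+ 2) * K3 omega N z.
Proof.
rewrite /N' right_value d2p_E -/g1; congr (_ - _).
have E : lam * sin th / Q = K8 omega N * cos omega - K1 omega N * sin omega.
  rewrite /K8 /K1 (_ : omega * (h + 1) = th + omega); last by ring.
  rewrite (_ : omega * (1 + h) = th + omega); last by ring.
  have -> : sin th = sin (th + omega) * cos omega - cos (th + omega) * sin omega.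
    by rewrite -sinB addrK.
  by rewrite /lambda_den; field.
have -> : lam * sin th / (Q * cos omega) = (lam * sin th / Q) / cos omega.
  by field; rewrite hcos Q0.
by rewrite E; field.
Qed.

(** The equation says that the extended weight at the index -1 is zero. *)
Let eq_left : A11 omega N * dm + A12 omega N * dp = S1 omega N z.
Proof.
have E0 : right_sum 0 = K4 omega N z + lam ^+ N * N'.
  have := two_sided_sum_nat (leq0n N); rewrite subn0 expr0 mul1r.
  have -> : \sum_(g < N.+1) lam ^+ `|0 - (g : nat)%:Z|%N * G (z - h * (g : nat)%:R) =
    K4 omega N z.
    by apply: eq_bigr => g _; congr (_ ^+ _ * _); clear; lia.
  by have := left_sum_rec 0; rewrite sub0r -/M => <-; move=> H; move: H; lra.
have En : right_sum (-1) - data (-1) = lam * right_sum 0 by rewrite -(right_sum_rec (-1))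
  addNr; ring.
have Em : left_sum (-1) = M / lam by rewrite /M mulrC mulKf.
have := local_part_out (j := -1) isT; rewrite /local_part -(addrA (left_sum _)) En Em E0 addNr.
rewrite (_ : -1 - 1 = - 2%:Z)// (data_left 2) (data_left 1) (data_node (leq0n N)) mulr0
  subr0 /G.
rewrite /M left_value right_value_reduced => E.
apply/eqP; rewrite -subr_eq0 -[X in _ == X]E; apply/eqP.
rewrite /A11 /A12 /S1 -/Q (_ : 2 * omega * h = 2 * th); last by ring.
rewrite (_ : omega * (h + z) = 1 * th + omega * z); last by ring.
rewrite (_ : omega * (2 * h + z) = 2 * th + omega * z); last by ring.
rewrite /g1 exprS !mul1r; field.
by rewrite hcos w0 Q0 hlam0.
Qed.

(** The equation says that the extended weight at the index N + 1 is zero. *)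
Let eq_right : A21 omega N * dm + A22 omega N * dp = S2 omega N z.
Proof.
have E0 : left_sum N = lam ^+ N * K7 omega N z + lam ^+ N * M.
  have := two_sided_sum_nat (leqnn N); rewrite subnn expr0 mul1r.
  have -> : \sum_(g < N.+1) lam ^+ `|N%:Z - (g : nat)%:Z|%N * G (z - h * (g : nat)%:R) =
    lam ^+ N * K7 omega N z.
    rewrite /K7 mulr_sumr; apply: eq_bigr => g _; rewrite [RHS]mulrA; congr (_ * _).
    have gN : (g <= N)%N by rewrite -ltnS.
    have -> : lam ^+ N = lam ^+ (N - g) * lam ^+ g by rewrite -exprD subnK.
    rewrite mulfK ?expf_neq0//.
    by congr (_ ^+ _); move: gN; clear; lia.
  by have := right_sum_rec N; rewrite -/N' => <-; lra.
have Em : left_sum (N%:Z + 1) - data (N%:Z + 1) =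
  lam * left_sum N by rewrite -(left_sum_rec (N%:Z + 1)) addrK; ring.
have En : right_sum (N%:Z + 1) = N' / lam by rewrite /N' mulrC mulKf.
have jout : (N%:Z + 1 < 0) || (N%:Z < N%:Z + 1) by apply/orP; right; clear; lia.
have := local_part_out jout; rewrite /local_part addrK (addrAC (left_sum _)) Em En E0
  -(addrA N%:Z).
rewrite (_ : 1 + 1 = 2%:Z)// (data_right_reduced 2) (data_right_reduced 1) (data_node
  (leqnn N)) hNE /G.
rewrite /M left_value right_value_reduced => E.
apply/eqP; rewrite -subr_eq0 -[X in _ == X]E; apply/eqP.
rewrite /A21 /A22 /S2 /K6 -/Q (_ : 2 * omega * h = 2 * th); last by ring.
rewrite (_ : omega * h * N.+1%:R = 1 * th + omega); last first.
  by rewrite -natr1 -mulrA mulrDr hNE; ring.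
rewrite (_ : omega * h * N.+2%:R = 2 * th + omega); last first.
  by rewrite -!natr1 -mulrA !mulrDr hNE; ring.
rewrite addn1 addn2 /g1 exprS !mul1r; field.
by rewrite hcos w0 Q0 hlam0.
Qed.

Hypothesis hdet : A11 omega N * A22 omega N - A21 omega N * A12 omega N != 0.

Let dm_E : dm = d1_minus omega N z.
Proof. by rewrite /d1_minus /A_det -eq_left -eq_right; field. Qed.

Let dp_E : dp = d1_plus omega N z.
Proof. by rewrite /d1_plus /A_det -eq_left -eq_right; field. Qed.

Let d2p_E' : d2p = d2_plus omega N z.
Proof. by rewrite d2p_E dp_E. Qed.

Let M_E : M = M1 omega N z.
Proof. by rewrite /M left_value dm_E. Qed.

Let N'_E : N' = N1 omega N z.
Proof. by rewrite /N' right_value dp_E d2p_E'. Qed.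

Lemma coefficient_formula (g : 'I_N.+1) : c g = p * (local_part (g : nat)%:Z + A / lam *
  (\sum_(i < N.+1) lam ^+ `|(g : nat)%:Z - (i : nat)%:Z|%N * G2 omega (z - h * (i : nat)%:R)
   + lam ^+ g * M1 omega N z + lam ^+ (N - g) * N1 omega N z)).
Proof.
have gN : (g <= N)%N by rewrite -ltnS.
by rewrite -coef_node coef_formula (two_sided_sum_nat gN) M_E N'_E.
Qed.

Lemma formula_first : c ord0 =
  p * (- d1_minus omega N z * sin (omega * h) + d2_minus omega z * cos (omega * h)
       - h / (4 * omega ^+ 2) * cos (omega * (h + z))
       + C * G2 omega z + G2 omega (z - h)
       + A / lam * (\sum_(g < N.+1) lam ^+ g * G2 omega (z - h * (g : nat)%:R)
                    + M1 omega N z + lam ^+ N * N1 omega N z)).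
Proof.
rewrite coefficient_formula /= subn0 expr0 mul1r; congr (_ * (_ + _ * (_ + _ + _))); last first.
  by apply: eq_bigr => i _; congr (_ ^+ _ * _); clear; lia.
rewrite /local_part sub0r add0r (data_left 1) (data_node (leq0n N)) (data_node Npos) dm_E
  /G mulr0 subr0 mulr1 /d2_minus.
by rewrite (_ : omega * (h + z) = 1 * th + omega * z) ?mul1r//; ring.
Qed.

Lemma formula_middle (g : 'I_N.+1) : (1 <= g <= N.-1)%N -> c g =
  p * (G2 omega (z - h * (g%:R - 1)) + C * G2 omega (z - h * g%:R) +
    G2 omega (z - h * (g%:R + 1))
       + A / lam * (\sum_(i < N.+1) lam ^+ `|(g : nat)%:Z - (i : nat)%:Z|%N * G2 omega (z -
         h * (i : nat)%:R)
                    + lam ^+ g * M1 omega N z + lam ^+ (N - g) * N1 omega N z)).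
Proof.
move=> /andP[g1' gN]; rewrite coefficient_formula; congr (_ * (_ + _)).
have gn1 : ((g : nat)%:Z - 1 = (g.-1 : nat)%:Z) by move: g1'; clear; lia.
have gp1 : ((g : nat)%:Z + 1 = (g.+1 : nat)%:Z) by clear; lia.
have gR : (g.-1)%:R = g%:R - 1 :> R by rewrite -[in RHS](prednK g1') -natr1 addrK.
rewrite /local_part gn1 gp1 !data_node /G ?gR -?natr1//; move: g1' gN Npos; clear; lia.
Qed.

Lemma formula_last : c ord_max =
  p * (d1_plus omega N z * sin (omega * h * N.+1%:R) +
    d2_plus omega N z * cos (omega * h * N.+1%:R)
       - h * N.+1%:R / (4 * omega ^+ 2) * cos (omega * (h * N.+1%:R - z))
       + C * G2 omega (z - 1) + G2 omega (z - h * (N%:R - 1))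
       + A / lam * (\sum_(g < N.+1) lam ^+ (N - g) * G2 omega (z - h * (g : nat)%:R)
                    + lam ^+ N * M1 omega N z + N1 omega N z)).
Proof.
rewrite coefficient_formula /= subnn expr0 mul1r; congr (_ * (_ + _ * (_ + _ + _))); last first.
  apply: eq_bigr => i _; congr (_ ^+ _ * _); have := ltn_ord i; clear; lia.
have Nn1 : (N%:Z - 1 = (N.-1 : nat)%:Z) by move: Npos; clear; lia.
have NR : (N.-1)%:R = N%:R - 1 :> R by rewrite -[in RHS](prednK Npos) -natr1 addrK.
rewrite /local_part Nn1 (data_node (leq_pred N)) (data_node (leqnn N)) (data_right 1) dp_E
  d2p_E' /G NR hNE addn1.
rewrite (_ : omega * h * N.+1%:R = 1 * th + omega); last first.
  by rewrite -natr1 -mulrA mulrDr hNE; ring.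
by ring.
Qed.
End Formula.

(** * The optimal coefficients *)

Theorem theorem4p3 (R : realType) (omega : R) (N : nat) (z : R)
    (h := step R N) (G := G2 omega) (p := p_cst omega N) (C := C_cst omega N)
    (lam := lambda omega N) (A := A_cst omega N)
    (d1m := d1_minus omega N z) (d1p := d1_plus omega N z)
    (d2m := d2_minus omega z) (d2p := d2_plus omega N z)
    (M := M1 omega N z) (N' := N1 omega N z)
    (homega : omega != 0) (hN : (1 <= N)%N) (hz : 0 <= z <= 1)
    (hlam : `|lam| < 1)
    (hcos : cos omega != 0)
    (hden : sin (omega * h) - omega * h * cos (omega * h) != 0)
    (hlam0 : lam != 0) (hlam1 : lam ^+ 2 - 1 != 0)
    (hQ : lam ^+ 2 - 2 * lam * cos (omega * h) + 1 != 0)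
    (hdet : A11 omega N * A22 omega N - A21 omega N * A12 omega N != 0)
    (c : 'I_N.+1 -> R) :
  optimal_coefficients omega z c <->
  [/\ c ord0 =
        p * (- d1m * sin (omega * h) + d2m * cos (omega * h)
             - h / (4 * omega ^+ 2) * cos (omega * (h + z))
             + C * G z + G (z - h)
             + A / lam * (\sum_(g < N.+1) lam ^+ g * G (z - h * g%:R)
                          + M + lam ^+ N * N')),
      forall b : 'I_N.+1, (1 <= b <= N.-1)%N ->
        c b =
        p * (G (z - h * (b%:R - 1)) + C * G (z - h * b%:R)
             + G (z - h * (b%:R + 1))
             + A / lam * (\sum_(g < N.+1)
                            lam ^+ `|b%:Z - g%:Z|%N * G (z - h * g%:R)
                          + lam ^+ b * M + lam ^+ (N - b) * N'))
    & c ord_max =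
        p * (d1p * sin (omega * h * N.+1%:R) + d2p * cos (omega * h * N.+1%:R)
             - h * N.+1%:R / (4 * omega ^+ 2) * cos (omega * (h * N.+1%:R - z))
             + C * G (z - 1) + G (z - h * (N%:R - 1))
             + A / lam * (\sum_(g < N.+1) lam ^+ (N - g) * G (z - h * g%:R)
                          + lam ^+ N * M + N'))].
Proof.
have hs := sin_th_neq0 hden hlam hlam0.
have [c0 [a [b ci]]] := spline_system_exists z homega hN hs.
have F0 := formula_first homega hN hlam hcos hden hlam0 hlam1 hQ ci hdet.
have Fm := formula_middle homega hN hlam hcos hden hlam0 hlam1 hQ ci hdet.
have FN := formula_last homega hN hlam hcos hden hlam0 hlam1 hQ ci hdet.
split=> [opt|[c_first c_mid c_last]].
  have -> : c = c0 by apply/funext => i; exact: (optimal_unique homega hN hz ci opt).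
  by split.
suff -> : c = c0 by exact: (spline_system_optimal homega hN hz ci).
apply/funext => i; have [->|i0] := eqVneq i ord0; first by rewrite c_first F0.
have [->|iN] := eqVneq i ord_max; first by rewrite c_last FN.
have imid : (1 <= i <= N.-1)%N.
  rewrite lt0n i0 /= -ltnS prednK// ltn_neqAle -ltnS ltn_ord andbT.
  exact: iN.
by rewrite c_mid// Fm.
Qed.
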